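(* Let $\rho_0>\rho>0$, $s\in(0,1)$, $\xi_0\in\mathbb{H}^N$, $\alpha\in(0,1)$ and $c,B>0$. Let $u\in W^{1,2}(B_\rho(\xi_0))$ satisfy $$|\{u>c\}\cap B_\rho(\xi_0)|>\alpha|B_\rho(\xi_0)|\qquad\text{and}\qquad[u]_{W^{1,2}(B_\rho(\xi_0))}\le B.$$ Then for every $\delta,\lambda\in(0,1)$ there exist $\xi_*\in B_\rho(\xi_0)$ and a parameter $k=k(Q,s,\alpha,B,\delta,\lambda)\in(0,1)$ such that $$|\{u>\lambda c\}\cap B_{k\rho}(\xi_* )|>(1-\delta)|B_{k\rho}(\xi_* )|.$$
   Context: $N\ge1$, $\mathbb{H}^N=\mathbb{R}^{2N+1}$ is the Heisenberg group with points $\xi=(x,y,\Upsilon)$, $x,y\in\mathbb{R}^N$, $\Upsilon\in\mathbb{R}$, group law $\xi\circ\xi'=(x+x',y+y',\Upsilon+\Upsilon'+2(\langle x',y\rangle-\langle x,y'\rangle))$, homogeneous dimension $Q=2N+2$ and norm $|\xi|_{\mathbb{H}^N}=((|x|^2+|y|^2)^2+\Upsilon^2)^{1/4}$; $B_r(\xi_0)=\{\eta:|\eta^{-1}\circ\xi_0|_{\mathbb{H}^N}<r\}$; $|E|$ is Lebesgue measure. $\nabla_{\mathbb{H}^N}=(X_1,\dots,X_N,Y_1,\dots,Y_N)$ with $X_i=\partial_{x_i}+2y_i\partial_\Upsilon$, $Y_i=\partial_{y_i}-2x_i\partial_\Upsilon$. $W^{1,2}(U)=\{v\in L^2(U):\nabla_{\mathbb{H}^N}v\in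 L^2(U)\}$ and $[u]_{W^{1,2}(U)}=\left(\int_U|\nabla_{\mathbb{H}^N}u|^2\,d\xi\right)^{1/2}$.
   Formalization: The parameter k depends on B only through B/(cρ^N), so also on c and ρ (for c=ρ=1 it is k(Q,s,α,B,δ,λ)); a k independent of c and ρ is impossible, as rapidly oscillating u of small amplitude with c→0 shows. *)

(* Defs.v *)
From HB Require Import structures.
From mathcomp Require Import all_boot all_order all_algebra.
From mathcomp Require Import all_classical all_reals all_analysis.

Set Implicit Arguments.
Unset Strict Implicit.
Unset Printing Implicit Defensive.

Import Order.TTheory GRing.Theory Num.Theory.
Import numFieldNormedType.Exports.

Local Open Scope classical_set_scope.
Local Open Scope ring_scope.

Lemma product_sigma_finite d1 d2 (T1 : measurableType d1)
    (T2 : measurableType d2) (R : realType) (m1 : {measure set T1 -> \bar R})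
    (m2 : {sigma_finite_measure set T2 -> \bar R}) :
  sigma_finite setT m1 -> sigma_finite setT (m1 \x m2)%E.
Proof.
move=> /sigma_finiteP[F [TF ndF Foo]].
have /sigma_finiteP[G [TG ndG Goo]] := sigma_finiteT m2.
exists (fun n => F n `*` G n).
  rewrite -setXTT TF TG predeqE => -[x y]; split.
    move=> [/= [n _ Fnx] [k _ Gky]]; exists (maxn n k) => //; split.
    - by move: x Fnx; exact/subsetPset/ndF/leq_maxl.
    - by move: y Gky; exact/subsetPset/ndG/leq_maxr.
  by move=> [n _ []/= ? ?]; split; exists n.
move=> k; have [? ?] := Foo k; have [? ?] := Goo k.
split; first exact: measurableX.
by rewrite product_measure1E// lte_mul_pinfty// ge0_fin_numE.
Qed.

(* lebesgue_measure, transported from measurableTypeR R to R: the two types have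
   the same measurable sets but different displays, which matters for products. *)
Definition lebesgue_R (R : realType) : set R -> \bar R :=
  pushforward lebesgue_measure (id : measurableTypeR R -> R).

Section lebesgue_R_measure.
Variable R : realType.

Let lebesgue_R0 : lebesgue_R (@set0 R) = 0%E.
Proof. exact: measure0. Qed.

Let lebesgue_R_ge0 (A : set R) : (0 <= lebesgue_R A)%E.
Proof. exact: measure_ge0. Qed.

Let lebesgue_R_sigma_additive : semi_sigma_additive (@lebesgue_R R).
Proof. exact: (@measure_semi_sigma_additive _ _ _ (@lebesgue_measure R)). Qed.

HB.instance Definition _ := isMeasure.Build _ _ _ (@lebesgue_R R)
  lebesgue_R0 lebesgue_R_ge0 lebesgue_R_sigma_additive.

Let lebesgue_R_sigma_finite : sigma_finite setT (@lebesgue_R R).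
Proof. exact: (@sigma_finiteT _ _ _ (@lebesgue_measure R)). Qed.

HB.instance Definition _ := Measure_isSigmaFinite.Build _ _ _ (@lebesgue_R R)
  lebesgue_R_sigma_finite.

End lebesgue_R_measure.

(* 'rV[R]_n carries the sigma-algebra generated by the coordinates, that is the
   Borel sigma-algebra; this is what the library does for n.-tuple R. *)
Definition rV_display : measure_display. Proof. exact: default_measure_display. Qed.

Definition rV_coord (R : realType) (n : nat) (i : 'I_n) (v : 'rV[R]_n) : R :=
  v ord0 i.

Section rV_measurable.
Variables (R : realType) (n : nat).

Let coords : 'I_n -> 'rV[R]_n -> R := @rV_coord R n.

Let rV_set0 : g_sigma_preimage coords set0.
Proof. exact: sigma_algebra0. Qed.

Let rV_setC A : g_sigma_preimage coords A -> g_sigma_preimage coords (~` A).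
Proof. exact: sigma_algebraC. Qed.

Let rV_bigcup (F : (set 'rV[R]_n)^nat) :
  (forall i, g_sigma_preimage coords (F i)) ->
  g_sigma_preimage coords (\bigcup_i (F i)).
Proof. exact: sigma_algebra_bigcup. Qed.

HB.instance Definition _ := @isMeasurable.Build rV_display
  'rV[R]_n (g_sigma_preimage coords) rV_set0 rV_setC rV_bigcup.

End rV_measurable.

Lemma measurable_rV_coord (R : realType) n (i : 'I_n) :
  measurable_fun [set: 'rV[R]_n] (@rV_coord R n i).
Proof.
move=> _ Y mY; rewrite setTI; apply: sub_sigma_algebra => /=.
rewrite -bigcup_seq/=; exists i => /=; first by rewrite mem_index_enum.
by exists Y => //; rewrite setTI.
Qed.

Lemma measurable_fun_rV d (T : measurableType d) (R : realType) n
    (f : T -> 'rV[R]_n) :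
  (forall i, measurable_fun [set: T] (fun x => f x ord0 i)) ->
  measurable_fun [set: T] f.
Proof.
move=> mf _ A mA; rewrite setTI.
have : g_sigma_preimage (fun i => @rV_coord R n i \o f) `<=` measurable.
  apply: smallest_sub; first exact: sigma_algebra_measurable.
  move=> B; rewrite -bigcup_seq/= => -[i _ [C mC <-]].
  exact: mf.
rewrite g_sigma_preimage_comp; apply.
by exists A => //; rewrite setTI.
Qed.

Section rV_cons.
Variables (R : realType) (n : nat).

Definition rV_cons (p : R * 'rV[R]_n) : 'rV[R]_n.+1 :=
  \row_i oapp (p.2 ord0) p.1 (unlift ord0 i).

Definition rV_uncons (v : 'rV[R]_n.+1) : R * 'rV[R]_n :=
  (v ord0 ord0, \row_i v ord0 (lift ord0 i)).

Lemma rV_consK : cancel rV_cons rV_uncons.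
Proof.
move=> [a v]; rewrite /rV_uncons mxE unlift_none/=; congr pair.
by apply/rowP => i; rewrite !mxE liftK.
Qed.

Lemma measurable_rV_cons : measurable_fun [set: R * 'rV[R]_n] rV_cons.
Proof.
apply: measurable_fun_rV => i; rewrite /rV_cons.
under eq_fun do rewrite mxE.
case: unliftP => [j _|_] /=; last exact: measurable_fst.
exact: (measurableT_comp (@measurable_rV_coord R n j) measurable_snd).
Qed.

Lemma measurable_rV_uncons : measurable_fun [set: 'rV[R]_n.+1] rV_uncons.
Proof.
apply/measurable_fun_pair; first exact: measurable_rV_coord.
apply: measurable_fun_rV => i; under eq_fun do rewrite mxE.
exact: measurable_rV_coord.
Qed.

HB.instance Definition _ :=
  isMeasurableFun.Build _ _ _ _ rV_cons measurable_rV_cons.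

Variable mu : {sigma_finite_measure set 'rV[R]_n -> \bar R}.

Definition rV_cons_measure : set 'rV[R]_n.+1 -> \bar R :=
  pushforward (@lebesgue_R R \x mu)%E rV_cons.

Let rV_cons_measure0 : rV_cons_measure set0 = 0%E.
Proof. exact: measure0. Qed.

Let rV_cons_measure_ge0 A : (0 <= rV_cons_measure A)%E.
Proof. exact: measure_ge0. Qed.

Let rV_cons_measure_sigma_additive : semi_sigma_additive rV_cons_measure.
Proof. exact: measure_semi_sigma_additive. Qed.

HB.instance Definition _ := isMeasure.Build _ _ _ rV_cons_measure
  rV_cons_measure0 rV_cons_measure_ge0 rV_cons_measure_sigma_additive.

Let rV_cons_measure_sigma_finite : sigma_finite setT rV_cons_measure.
Proof.
have [F FT Foo] : sigma_finite setT (@lebesgue_R R \x mu)%E.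
  exact/product_sigma_finite/sigma_finiteT.
exists (fun k => rV_uncons @^-1` F k).
  by rewrite -preimage_bigcup -FT preimage_setT.
move=> k; have [mF Fk] := Foo k; split.
  by rewrite -[X in measurable X]setTI; exact: measurable_rV_uncons.
rewrite /rV_cons_measure /pushforward -comp_preimage.
by rewrite (_ : _ \o _ = id) ?preimage_id//; apply/funext/rV_consK.
Qed.

HB.instance Definition _ := Measure_isSigmaFinite.Build _ _ _ rV_cons_measure
  rV_cons_measure_sigma_finite.

End rV_cons.

Fixpoint lebesgue_rV (R : realType) (n : nat) :
    {sigma_finite_measure set 'rV[R]_n -> \bar R} :=
  match n return {sigma_finite_measure set 'rV[R]_n -> \bar R} with
  | 0%N => dirac (0 : 'rV[R]_0)
  | m.+1 => rV_cons_measure (lebesgue_rV R m)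
  end.

Lemma lebesgue_rV_box (R : realType) (n : nat) (A : 'I_n -> set R) :
  (forall i, measurable (A i)) ->
  lebesgue_rV R n [set v : 'rV[R]_n | forall i, A i (v ord0 i)] =
    (\big[*%E/1]_(i < n) lebesgue_R (A i))%E.
Proof.
elim: n A => [|n IHn] A mA.
  by rewrite big_ord0 /= /dirac/= indicE mem_set//= => -[].
rewrite big_ord_recl -IHn => [|i]; last exact: mA.
have mB : measurable
    [set v : 'rV[R]_n | forall i, A (lift ord0 i) (v ord0 i)].
  rewrite (_ : mkset _ = \bigcap_(i in [set: 'I_n])
      (@rV_coord R n i @^-1` A (lift ord0 i))); last first.
    by apply/seteqP; split => v /= Av i; [move=> _|]; exact: Av.
  apply: fin_bigcap_measurable => // i _.
  by rewrite -[X in measurable X]setTI; exact: measurable_rV_coord.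
rewrite /= /rV_cons_measure /pushforward.
rewrite -[RHS]product_measure1E//; congr (_ _); apply/seteqP; split.
- move=> [a v] /= Av; split => /= [|i].
    by have := Av ord0; rewrite mxE unlift_none.
  by have := Av (lift ord0 i); rewrite mxE liftK.
- move=> [a v] /= [Aa Av] i; rewrite mxE.
  by case: unliftP => [j ->|->].
Qed.

Notation heis R N := ('rV[R]_N * 'rV[R]_N * R)%type.

Definition heis_measure (R : realType) (N : nat) : set (heis R N) -> \bar R :=
  (lebesgue_rV R N \x lebesgue_rV R N \x @lebesgue_R R)%E.
HB.instance Definition _ (R : realType) (N : nat) :=
  Measure.on (@heis_measure R N).

Lemma heis_measure_sigma_finite (R : realType) (N : nat) :
  sigma_finite setT (@heis_measure R N).
Proof. exact/product_sigma_finite/product_sigma_finite/sigma_finiteT. Qed.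

HB.instance Definition _ (R : realType) (N : nat) :=
  Measure_isSigmaFinite.Build _ _ _ (@heis_measure R N)
    (@heis_measure_sigma_finite R N).

Section heisenberg.
Variables (R : realType) (N : nat).
Implicit Types (xi eta : heis R N) (U : set (heis R N)).
Local Notation mu := (@heis_measure R N).

Definition dotv (x y : 'rV[R]_N) : R := \sum_(i < N) x ord0 i * y ord0 i.

Definition heis_mul xi eta : heis R N :=
  (xi.1.1 + eta.1.1, xi.1.2 + eta.1.2,
   xi.2 + eta.2 + 2 * (dotv eta.1.1 xi.1.2 - dotv xi.1.1 eta.1.2)).

(* The inverse for heis_mul is the opposite vector, see heis_mulVg. *)
Definition heis_inv xi : heis R N := - xi.

Definition heis_norm xi : R :=
  ((dotv xi.1.1 xi.1.1 + dotv xi.1.2 xi.1.2) ^+ 2 + xi.2 ^+ 2) `^ (4^-1).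

Definition heis_ball xi0 (r : R) : set (heis R N) :=
  [set eta | heis_norm (heis_mul (heis_inv eta) xi0) < r].

Lemma heis_mulVg xi : heis_mul (heis_inv xi) xi = 0.
Proof.
rewrite /heis_mul /heis_inv /= !addNr add0r.
suff -> : dotv xi.1.1 (- xi.1.2) = dotv (- xi.1.1) xi.1.2 by rewrite subrr mulr0.
by apply: eq_bigr => i _; rewrite !mxE mulrN mulNr.
Qed.

Definition dx (i : 'I_N) : heis R N := (delta_mx ord0 i, 0, 0).
Definition dy (i : 'I_N) : heis R N := (0, delta_mx ord0 i, 0).
Definition dT : heis R N := (0, 0, 1).

Definition heis_X (i : 'I_N) (f : heis R N -> R) xi : R :=
  'D_(dx i) f xi + 2 * xi.1.2 ord0 i * 'D_dT f xi.

Definition heis_Y (i : 'I_N) (f : heis R N -> R) xi : R :=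
  'D_(dy i) f xi - 2 * xi.1.1 ord0 i * 'D_dT f xi.

Fixpoint Ck (k : nat) (f : heis R N -> R) : Prop :=
  continuous f /\
  if k is m.+1 then
    forall v, (forall xi, derivable f xi v) /\ Ck m (fun xi => 'D_v f xi)
  else True.

Definition test_function U (phi : heis R N -> R) : Prop :=
  (forall k, Ck k phi) /\
  exists K, [/\ compact K, K `<=` U & forall xi, ~ K xi -> phi xi = 0].

Definition L2 U (f : heis R N -> R) : Prop :=
  measurable_fun U f /\ mu.-integrable U (fun xi => (f xi ^+ 2)%:E).

(* g collects the horizontal derivatives: (g xi).1 for X_1, ..., X_N and
   (g xi).2 for Y_1, ..., Y_N. The minus sign comes from the fact that X_i and
   Y_i are divergence free, hence formally skew-adjoint. *)
Definition weak_hgrad U (u : heis R N -> R)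
    (g : heis R N -> 'rV[R]_N * 'rV[R]_N) : Prop :=
  forall phi, test_function U phi -> forall i : 'I_N,
    (\int[mu]_(xi in U) (u xi * heis_X i phi xi)%:E =
       - \int[mu]_(xi in U) ((g xi).1 ord0 i * phi xi)%:E)%E /\
    (\int[mu]_(xi in U) (u xi * heis_Y i phi xi)%:E =
       - \int[mu]_(xi in U) ((g xi).2 ord0 i * phi xi)%:E)%E.

Definition L2_weak_hgrad U (u : heis R N -> R)
    (g : heis R N -> 'rV[R]_N * 'rV[R]_N) : Prop :=
  (forall i : 'I_N, L2 U (fun xi => (g xi).1 ord0 i) /\
                    L2 U (fun xi => (g xi).2 ord0 i)) /\
  weak_hgrad U u g.

Definition W12 U (u : heis R N -> R) : Prop :=
  L2 U u /\ exists g, L2_weak_hgrad U u g.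

(* The weak gradient is unique only almost everywhere; hgrad selects one. *)
Definition hgrad U (u : heis R N -> R) : heis R N -> 'rV[R]_N * 'rV[R]_N :=
  xget (fun=> 0) [set g | L2_weak_hgrad U u g].

Definition W12_seminorm U (u : heis R N -> R) : R :=
  Num.sqrt (\int[mu]_(xi in U)
    (dotv (hgrad U u xi).1 (hgrad U u xi).1 +
     dotv (hgrad U u xi).2 (hgrad U u xi).2)).

(* {u > t} for a function u whose domain is U: only the values of u on U count,
   also when this set is intersected with a ball that sticks out of U. *)
Definition superlevel U (u : heis R N -> R) (t : R) : set (heis R N) :=
  [set xi | U xi /\ t < u xi].

(* Bound for the seminorm after rescaling to radius 1 and level 1: with the
   dilations (x, y, T) |-> (rho x, rho y, rho^2 T), if the seminorm of u on a ball
   of radius rho is at most B, then that of (u o dilation) / c on the ball of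
   radius 1 is at most rho^(1 - Q/2) B / c, where 1 - Q/2 = - N. *)
Definition scaled_bound (c rho B : R) : R := B / (c * rho ^+ N).

End heisenberg.

(* Main.v *)
Require Import Defs.
From HB Require Import structures.
From mathcomp Require Import all_boot all_order all_algebra.
From mathcomp Require Import all_classical all_reals all_analysis measurable_realfun.
From mathcomp Require Import ring lra zify.

Set Implicit Arguments.
Unset Strict Implicit.
Unset Printing Implicit Defensive.

Import Order.TTheory GRing.Theory Num.Theory.
Import numFieldNormedType.Exports.

Local Open Scope classical_set_scope.
Local Open Scope ring_scope.

(** Why the theorem holds. Let U be the ball of radius rho, K a slightly smaller
    concentric ball, and h = k rho. The heart of the matter is the estimate, for
    zeta of norm at most h and n = 2 N + 4,

      int_K |u (x zeta) - u x| dx <= n h G,   G >= max_d int_U |X_d u|,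

    where X_d runs over the 2 N horizontal fields (lemma reachable_ball). It
    rests on the following points.

    - For zeta = exp (t X_d) it is horizontal_translation_le. Tested against a
      smooth function phi with values in [-1, 1], the difference
      u (x exp (t X_d)) - u x integrates to the increment between 0 and - t of
      int u phi (x exp (s X_d)) dx, whose derivative in s is minus the pairing of
      phi (x exp (s X_d)) with the weak derivative of u, hence at most G
      (translation_test_le). Such phi are enough to compute an L^1 norm, because
      indicator functions are limits of smooth functions
      (integral_abs_le_smooth).

    - The vertical direction is a commutator of horizontal ones, so that every
      zeta of norm at most h is a product of n factors exp (t X_d) with
      |t| <= h. The norm satisfies the triangle inequality (heis_normM) and
      translations preserve the measure, so the n estimates add up.

    Average over zeta in the ball of radius h and exchange the integrals: some x
    in {u > c}, which fills a fixed fraction of K (superlevel_shrunk_ball),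
    has mean oscillation of u over its ball of radius h at most
    n h G / |{u > c} /\ K| (exists_small_mean_oscillation). By Chebyshev's
    inequality u > lambda c on all but a fraction delta of this ball as soon as
    the mean oscillation is below delta (1 - lambda) c (superlevel_density).

    Cauchy-Schwarz gives G of order B rho^(N+1), and the measure of U is of order
    rho^(2N+2). The condition thus reads k b <= const with b = B / (c rho^N), and
    k b = kappa / (1 + b) fulfils it together with n h < rho - radius of K. *)

(** * Maps that scale a measure *)

Lemma measurable_preimage d1 d2 (T1 : measurableType d1) (T2 : measurableType d2)
    (f : T1 -> T2) (A : set T2) :
  measurable_fun setT f -> measurable A -> measurable (f @^-1` A).
Proof. by move=> mf mA; rewrite -[X in measurable X]setTI; exact: mf. Qed.

Lemma measurable_gt d (T : measurableType d) (R : realType) (f : T -> R) (t : R) :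
  measurable_fun setT f -> measurable [set x | t < f x].
Proof.
move=> mf; rewrite (_ : mkset _ = f @^-1` `]t, +oo[%classic).
  exact: measurable_preimage.
by apply/seteqP; split => x /=; rewrite in_itv /= andbT.
Qed.

Definition scales_measure d (T : measurableType d) (R : realType)
    (m : set T -> \bar R) (c : R) (f : T -> T) :=
  measurable_fun setT f /\
  forall A, measurable A -> m (f @^-1` A) = (c%:E * m A)%E.

Lemma scales_integral d (T : measurableType d) (R : realType)
    (m : {measure set T -> \bar R}) (c : R) (f : T -> T) (h : T -> \bar R) :
  0 <= c -> scales_measure m c f ->
  measurable_fun setT h -> (forall x, 0 <= h x)%E ->
  (\int[m]_x h (f x) = c%:E * \int[m]_x h x)%E.
Proof.
move=> c0 [mf fE] mh h0.
have := ge0_integral_pushforward mf m measurableT mh (fun x _ => h0 x).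
rewrite preimage_setT => <-.
rewrite [LHS](eq_measure_integral (mscale (NngNum c0) m)) => [|A mA _].
  by rewrite ge0_integral_mscale.
by rewrite /= /pushforward /mscale fE.
Qed.

(** The map may translate or shear the second factor by an amount that depends on
    the first one: by Tonelli's formula only the fibers matter. Group
    translations and dilations of the Heisenberg group have this form. *)
Lemma scales_skew_product d1 d2 (T1 : measurableType d1) (T2 : measurableType d2)
    (R : realType) (m1 : {measure set T1 -> \bar R})
    (m2 : {sigma_finite_measure set T2 -> \bar R})
    (c1 c2 : R) (f : T1 -> T1) (g : T1 -> T2 -> T2) :
  0 <= c1 -> 0 <= c2 -> scales_measure m1 c1 f ->
  measurable_fun setT (fun z : T1 * T2 => g z.1 z.2) ->
  (forall x, scales_measure m2 c2 (g x)) ->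
  scales_measure (m1 \x m2)%E (c1 * c2) (fun z => (f z.1, g z.1 z.2)).
Proof.
move=> c10 c20 Hf mg Hg; split.
  apply/measurable_fun_pair => //=.
  exact: (measurableT_comp Hf.1 measurable_fst).
move=> A mA; rewrite /product_measure1 /=.
transitivity (\int[m1]_x (c2%:E * (m2 \o xsection A) (f x)))%E.
  apply: eq_integral => x _ /=.
  rewrite -(Hg x).2; last exact: measurable_xsection.
  by congr (m2 _); apply/seteqP; split => y; rewrite /xsection /= !inE.
have mx : measurable_fun setT (m2 \o xsection A).
  exact: measurable_fun_xsection.
rewrite ge0_integralZl//; last exact: (measurableT_comp mx Hf.1).
by rewrite (scales_integral c10 Hf)// muleA EFinM (muleC c1%:E).
Qed.

Section lebesgue_affine.
Variable R : realType.

Lemma scales_lebesgue_R (a t : R) : 0 < t ->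
  scales_measure (@lebesgue_R R) t^-1 (fun x => a + t * x).
Proof.
move=> t0.
have mf : measurable_fun [set: R] (fun x => a + t * x).
  by apply: measurable_funD => //; exact: measurable_funM.
split=> // A mA.
pose f' : measurableTypeR R -> measurableTypeR R := fun x => a + t * x.
have mf' : measurable_fun setT f' := mf.
pose m'' : {measure set (measurableTypeR R) -> \bar R} := 
  mscale (NngNum (ltW t0)) (pushforward (@lebesgue_measure R) f').
have E : lebesgue_measure A = m'' mf' A.
  apply: lebesgue_measure_unique => // X [[u v] /= uv <-].
  rewrite /m'' /mscale /= /pushforward /=.
  have -> : f' @^-1` `]u, v]%classic = `](u - a) / t, (v - a) / t]%classic.
    apply/seteqP; split => x /=; rewrite /f' !in_itv /= ltr_pdivrMr// ler_pdivlMr//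
      ltrBlDl lerBrDl [x * t]mulrC //.
  rewrite !lebesgue_measure_itv /= !lte_fin ltr_pM2r ?invr_gt0// ltrD2r.
  case: ifP => _; last by rewrite mule0.
  rewrite -!EFinD -EFinM; congr EFin; field; exact: lt0r_neq0.
rewrite /lebesgue_R /pushforward /= E /m'' /mscale /= muleA -EFinM mulVf ?mul1e//.
exact: lt0r_neq0.
Qed.

Lemma measurable_fun_rV_affine n (a : 'rV[R]_n) (t : R) :
  measurable_fun setT (fun v : 'rV[R]_n => a + t *: v).
Proof.
apply: measurable_fun_rV => i; under eq_fun do rewrite !mxE.
apply: measurable_funD => //; apply: measurable_funM => //.
exact: measurable_rV_coord.
Qed.

Lemma scales_lebesgue_rV n (a : 'rV[R]_n) (t : R) : 0 < t ->
  scales_measure (lebesgue_rV R n) (t^-1 ^+ n) (fun v => a + t *: v).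
Proof.
move=> t0; elim: n a => [a|n IHn a].
  split=> [|A mA]; first exact: measurable_fun_rV_affine.
  rewrite expr0 mul1e; congr (lebesgue_rV R 0 _); apply/seteqP.
  by split => x /=; rewrite (thinmx0 (a + t *: x)) (thinmx0 x).
split=> [|A mA]; first exact: measurable_fun_rV_affine.
have t10 : 0 <= t^-1 by rewrite invr_ge0 ltW.
have [_ H] := @scales_skew_product _ _ _ _ _ (@lebesgue_R R) (lebesgue_rV R n)
  _ _ (fun x => (a ord0 ord0) + t * x)
  (fun _ v => (\row_i a ord0 (lift ord0 i)) + t *: v)
  t10 (exprn_ge0 n t10) (scales_lebesgue_R (a ord0 ord0) t0)
  (measurableT_comp (measurable_fun_rV_affine _ _) measurable_snd)
  (fun=> IHn (\row_i a ord0 (lift ord0 i))).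
rewrite /= /rV_cons_measure /pushforward exprS -H; last first.
  exact: measurable_preimage (@measurable_rV_cons R n) mA.
congr (product_measure1 _ _ _); rewrite -[LHS]comp_preimage -[RHS]comp_preimage.
congr (_ @^-1` A); apply/funext => -[x v]; apply/rowP => i.
rewrite /= /rV_cons !mxE; case: unliftP => [j ->|->] /=; by rewrite ?mxE.
Qed.

End lebesgue_affine.

(** * The Heisenberg group and its norm *)

Section dot_product.
Variables (R : realType) (N : nat).
Implicit Types x y z : 'rV[R]_N.

Lemma dotvC x y : dotv x y = dotv y x.
Proof. by apply: eq_bigr => i _; rewrite mulrC. Qed.

Lemma dotvDl x y z : dotv (x + y) z = dotv x z + dotv y z.
Proof. by rewrite /dotv -big_split; apply: eq_bigr => i _; rewrite mxE mulrDl. Qed.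

Lemma dotvDr x y z : dotv z (x + y) = dotv z x + dotv z y.
Proof. by rewrite dotvC dotvDl !(dotvC z). Qed.

Lemma dotvZl (a : R) x z : dotv (a *: x) z = a * dotv x z.
Proof. by rewrite /dotv mulr_sumr; apply: eq_bigr => i _; rewrite mxE mulrA. Qed.

Lemma dotvZr (a : R) x z : dotv z (a *: x) = a * dotv z x.
Proof. by rewrite dotvC dotvZl dotvC. Qed.

Lemma dotvNl x z : dotv (- x) z = - dotv x z.
Proof. by rewrite -scaleN1r dotvZl mulN1r. Qed.

Lemma dotvNr x z : dotv z (- x) = - dotv z x.
Proof. by rewrite dotvC dotvNl dotvC. Qed.

Lemma dotv0l z : dotv (0 : 'rV[R]_N) z = 0.
Proof. by rewrite -(scale0r (0 : 'rV[R]_N)) dotvZl mul0r. Qed.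

Lemma dotv0r z : dotv z (0 : 'rV[R]_N) = 0.
Proof. by rewrite dotvC dotv0l. Qed.

Lemma dotvv_ge0 x : 0 <= dotv x x.
Proof. by apply: sumr_ge0 => i _; rewrite -expr2 sqr_ge0. Qed.

Lemma sqr_coord_le_dotvv x i : x ord0 i ^+ 2 <= dotv x x.
Proof.
rewrite /dotv (bigD1 i)//= -expr2 lerDl.
by apply: sumr_ge0 => j _; rewrite -expr2 sqr_ge0.
Qed.

Lemma dotv_delta_r x i : dotv x (delta_mx ord0 i) = x ord0 i.
Proof.
rewrite /dotv (bigD1 i)//= big1 ?addr0 ?mxE ?eqxx ?mulr1// => j /negbTE ji.
by rewrite mxE ji andbF mulr0.
Qed.

Lemma dotv_delta_l x i : dotv (delta_mx ord0 i) x = x ord0 i.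
Proof. by rewrite dotvC dotv_delta_r. Qed.

Definition dotvE := (dotvDl, dotvDr, dotvZl, dotvZr, dotvNl, dotvNr,
  dotv0l, dotv0r).

End dot_product.

Section heisenberg_group.
Variables (R : realType) (N : nat).
Local Notation V := (heis R N).
Implicit Types xi eta zeta : V.

Lemma heis_mulA xi eta zeta :
  heis_mul xi (heis_mul eta zeta) = heis_mul (heis_mul xi eta) zeta.
Proof.
by rewrite /heis_mul /= !addrA; congr (_, _, _); rewrite !dotvE; ring.
Qed.

Lemma heis_mulg0 xi : heis_mul xi 0 = xi.
Proof.
by case: xi => -[x y] t; rewrite /heis_mul /= !addr0 !dotvE subrr mulr0 addr0.
Qed.

Lemma heis_mul0g xi : heis_mul 0 xi = xi.
Proof.
by case: xi => -[x y] t; rewrite /heis_mul /= !add0r !dotvE subrr mulr0 addr0.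
Qed.

Lemma heis_invK xi : heis_inv (heis_inv xi) = xi.
Proof. exact: opprK. Qed.

Lemma heis_mulgV xi : heis_mul xi (heis_inv xi) = 0.
Proof. by rewrite -{1}(heis_invK xi) heis_mulVg. Qed.

Lemma heis_mulVK xi eta : heis_mul (heis_inv xi) (heis_mul xi eta) = eta.
Proof. by rewrite heis_mulA heis_mulVg heis_mul0g. Qed.

Lemma heis_mulKV xi eta : heis_mul xi (heis_mul (heis_inv xi) eta) = eta.
Proof. by rewrite heis_mulA heis_mulgV heis_mul0g. Qed.

Lemma heis_invM xi eta :
  heis_inv (heis_mul xi eta) = heis_mul (heis_inv eta) (heis_inv xi).
Proof.
rewrite -[LHS](heis_mulVK eta); congr heis_mul.
by rewrite -[LHS](heis_mulVK xi) [heis_mul xi _]heis_mulA heis_mulgV heis_mulg0.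
Qed.

Definition heis_gauge xi : R :=
  (dotv xi.1.1 xi.1.1 + dotv xi.1.2 xi.1.2) ^+ 2 + xi.2 ^+ 2.

Lemma heis_gauge_ge0 xi : 0 <= heis_gauge xi.
Proof. by rewrite addr_ge0// sqr_ge0. Qed.

Lemma heis_norm_ge0 xi : 0 <= heis_norm xi.
Proof. exact: powR_ge0. Qed.

Lemma heis_norm_pow4 xi : heis_norm xi ^+ 4 = heis_gauge xi.
Proof.
by rewrite /heis_norm -powR_mulrn ?powR_ge0// -powRrM mulVf// powRr1// heis_gauge_ge0.
Qed.

Lemma heis_norm_lt xi (r : R) : 0 < r -> (heis_norm xi < r) = (heis_gauge xi < r ^+ 4).
Proof.
by move=> r0; rewrite -heis_norm_pow4 ltr_pXn2r// ?nnegrE ?heis_norm_ge0 ?ltW.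
Qed.

Lemma heis_norm_le xi (r : R) : 0 <= r -> (heis_norm xi <= r) = (heis_gauge xi <= r ^+ 4).
Proof.
by move=> r0; rewrite -heis_norm_pow4 ler_pXn2r// ?nnegrE ?heis_norm_ge0.
Qed.

Lemma heis_normV xi : heis_norm (heis_inv xi) = heis_norm xi.
Proof. by rewrite /heis_norm /heis_inv /= !dotvE !opprK sqrrN. Qed.

(** The two squares on the left are those of the real and imaginary parts of the
    Hermitian product of x + i y and x' + i y'. *)
Lemma dotv_sympl_cauchy_schwarz (x y x' y' : 'rV[R]_N) :
  (dotv x x' + dotv y y') ^+ 2 + (dotv x' y - dotv x y') ^+ 2 <=
  (dotv x x + dotv y y) * (dotv x' x' + dotv y' y').
Proof.
set S := dotv x x' + _; set W := _ - _; set a := dotv x x + _; set b := dotv x' x' + _.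
have a0 : 0 <= a by rewrite addr_ge0// dotvv_ge0.
have b0 : 0 <= b by rewrite addr_ge0// dotvv_ge0.
(* The inequality multiplied by a says that a times the difference of (x', y')
   and its projection on the complex line spanned by (x, y) has a nonnegative
   squared norm; multiplied by b, the same with the roles exchanged. *)
have Ha : 0 <= a * (a * b - (S ^+ 2 + W ^+ 2)).
  have := addr_ge0 (dotvv_ge0 (a *: x' - (S *: x + W *: y)))
                   (dotvv_ge0 (a *: y' - (S *: y - W *: x))).
  rewrite !dotvE ?(dotvC y x) ?(dotvC x' x) ?(dotvC y' y) ?(dotvC y' x) ?(dotvC y x').
  congr (_ <= _); rewrite /a /b /S /W (dotvC x' y); ring.
have Hb : 0 <= b * (a * b - (S ^+ 2 + W ^+ 2)).
  have := addr_ge0 (dotvv_ge0 (b *: x - (S *: x' - W *: y')))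
                   (dotvv_ge0 (b *: y - (S *: y' + W *: x'))).
  rewrite !dotvE ?(dotvC y x) ?(dotvC x' x) ?(dotvC y' y) ?(dotvC y' x) ?(dotvC y x')
    ?(dotvC y' x').
  congr (_ <= _); rewrite /a /b /S /W (dotvC x' y); ring.
rewrite -subr_ge0; move: a0; rewrite le_eqVlt => /orP[/eqP a0|a0]; last first.
  by rewrite -(pmulr_rge0 _ a0).
move: b0; rewrite le_eqVlt => /orP[/eqP b0|b0]; last first.
  by rewrite -(pmulr_rge0 _ b0).
have S2 : `|S| *+ 2 <= a + b.
  have H1 := addr_ge0 (dotvv_ge0 (x + x')) (dotvv_ge0 (y + y')).
  have H2 := addr_ge0 (dotvv_ge0 (x - x')) (dotvv_ge0 (y - y')).
  move: H1 H2; rewrite !dotvE ?(dotvC x' x) ?(dotvC y' y) => H1 H2.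
  by case: (ger0P S) => _; move: H1 H2; rewrite /a /b /S; lra.
have W2 : `|W| *+ 2 <= a + b.
  have H1 := addr_ge0 (dotvv_ge0 (y + x')) (dotvv_ge0 (x - y')).
  have H2 := addr_ge0 (dotvv_ge0 (y - x')) (dotvv_ge0 (x + y')).
  move: H1 H2; rewrite !dotvE ?(dotvC y x') ?(dotvC y' x) => H1 H2.
  by case: (ger0P W) => _; move: H1 H2; rewrite /a /b /W; lra.
have S0 : S = 0 by apply/eqP; rewrite -normr_eq0; apply/eqP; move: S2 (normr_ge0 S);
  rewrite -a0 -b0; lra.
have W0 : W = 0 by apply/eqP; rewrite -normr_eq0; apply/eqP; move: W2 (normr_ge0 W);
  rewrite -a0 -b0; lra.
by rewrite S0 W0 -a0 -b0; lra.
Qed.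

(** Cygan's triangle inequality. The constant 2 in the group law is what makes the
    vertical coordinate of a product the imaginary part of a sum of three complex
    numbers, to which the triangle inequality of the plane applies. *)
Lemma heis_normM xi eta :
  heis_norm (heis_mul xi eta) <= heis_norm xi + heis_norm eta.
Proof.
rewrite heis_norm_le ?addr_ge0 ?heis_norm_ge0//.
have := heis_norm_pow4 xi; have := heis_norm_pow4 eta.
have := heis_norm_ge0 xi; have := heis_norm_ge0 eta.
move: (heis_norm xi) (heis_norm eta) => a b b0 a0.
case: xi eta => -[x y] t [[x' y'] t']; rewrite /heis_gauge /=.
have := dotv_sympl_cauchy_schwarz x y x' y'.
rewrite !dotvE ?(dotvC x' x) ?(dotvC y' y).
have := addr_ge0 (dotvv_ge0 x) (dotvv_ge0 y).
have := addr_ge0 (dotvv_ge0 x') (dotvv_ge0 y').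
set z := dotv x x + _; set w := dotv x' x' + _.
set S := dotv x x' + _; set W := _ - _.
have -> : dotv x x + dotv x x' + (dotv x x' + dotv x' x') +
  (dotv y y + dotv y y' + (dotv y y' + dotv y' y')) = z + w + 2 * S.
  by rewrite /z /w /S; ring.
move: z w S W => z w S W w0 z0 CS Eb Ea.
(* In R^2 the vectors (z, t), (w, t') and (S, W) have norms a^2, b^2 and at most
   a b; the gauge is the squared norm of the first plus the second plus twice
   the third. *)
have dot2 (p q p' q' m : R) : 0 <= m -> 
    (p ^+ 2 + q ^+ 2) * (p' ^+ 2 + q' ^+ 2) <= m ^+ 2 -> p * p' + q * q' <= m.
  move=> m0 H; apply: le_trans (ler_norm _) _.
  rewrite -(ler_pXn2r (_ : 0 < 2)%N) ?nnegrE// real_normK ?num_real//.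
  apply: le_trans H; have := sqr_ge0 (p * q' - q * p'); nra.
have za : z <= a ^+ 2.
  rewrite -(ler_pXn2r (_ : 0 < 2)%N) ?nnegrE ?sqr_ge0// -exprM Ea lerDl sqr_ge0//.
have wb : w <= b ^+ 2.
  rewrite -(ler_pXn2r (_ : 0 < 2)%N) ?nnegrE ?sqr_ge0// -exprM Eb lerDl sqr_ge0//.
have SW : S ^+ 2 + W ^+ 2 <= (a * b) ^+ 2.
  by apply: le_trans CS _; rewrite exprMn ler_pM.
have ab0 : 0 <= a * b by rewrite mulr_ge0.
have H1 : z * w + t * t' <= a ^+ 2 * b ^+ 2.
  apply: dot2; first by rewrite mulr_ge0 ?sqr_ge0.
  by rewrite -Ea -Eb [leRHS]exprMn -!exprM.
have H2 : z * S + t * W <= a ^+ 2 * (a * b).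
  apply: dot2; first by rewrite mulr_ge0 ?sqr_ge0.
  by rewrite -Ea [leRHS]exprMn -exprM ler_wpM2l ?exprn_ge0.
have H3 : w * S + t' * W <= b ^+ 2 * (a * b).
  apply: dot2; first by rewrite mulr_ge0 ?sqr_ge0.
  by rewrite -Eb [leRHS]exprMn -exprM ler_wpM2l ?exprn_ge0.
have -> : (z + w + 2 * S) ^+ 2 + (t + t' + 2 * W) ^+ 2 =
   a ^+ 4 + b ^+ 4 + 2 * (z * w + t * t') + 4 * (S ^+ 2 + W ^+ 2)
   + 4 * (z * S + t * W) + 4 * (w * S + t' * W) by rewrite Ea Eb; ring.
have -> : (a + b) ^+ 4 = a ^+ 4 + b ^+ 4 + 2 * (a ^+ 2 * b ^+ 2) +
   4 * ((a * b) ^+ 2) + 4 * (a ^+ 2 * (a * b)) + 4 * (b ^+ 2 * (a * b)) by ring.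
by move: H1 H2 H3 SW; lra.
Qed.

Lemma heis_ball_mulr xi0 xi zeta (r s : R) :
  heis_ball xi0 r xi -> heis_norm zeta <= s ->
  heis_ball xi0 (r + s) (heis_mul xi zeta).
Proof.
rewrite /heis_ball /= => xir zs; rewrite heis_invM -heis_mulA.
by apply: le_lt_trans (heis_normM _ _) _; rewrite heis_normV addrC ltr_leD.
Qed.

End heisenberg_group.

(** * Measurability, invariance of the measure and volume of balls *)

Section heis_measurability.
Variables (R : realType) (N : nat).
Local Notation V := (heis R N).

Lemma measurable_fun_heis d (T : measurableType d) (f : T -> 'rV[R]_N)
    (g : T -> 'rV[R]_N) (h : T -> R) :
  measurable_fun setT f -> measurable_fun setT g -> measurable_fun setT h ->
  measurable_fun setT (fun x => (f x, g x, h x) : V).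
Proof.
by move=> mf mg mh; apply/measurable_fun_pair => //; apply/measurable_fun_pair.
Qed.

Lemma measurable_heis_x d (T : measurableType d) (f : T -> V) :
  measurable_fun setT f -> measurable_fun setT (fun z => (f z).1.1).
Proof.
move=> mf; apply: (measurableT_comp measurable_fst).
exact: (measurableT_comp measurable_fst).
Qed.

Lemma measurable_heis_y d (T : measurableType d) (f : T -> V) :
  measurable_fun setT f -> measurable_fun setT (fun z => (f z).1.2).
Proof.
move=> mf; apply: (measurableT_comp measurable_snd).
exact: (measurableT_comp measurable_fst).
Qed.

Lemma measurable_heis_t d (T : measurableType d) (f : T -> V) :
  measurable_fun setT f -> measurable_fun setT (fun z => (f z).2).
Proof. exact: measurableT_comp. Qed.

Lemma measurable_fun_coord d (T : measurableType d) (f : T -> 'rV[R]_N) i :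
  measurable_fun setT f -> measurable_fun setT (fun z => f z ord0 i).
Proof. exact: (measurableT_comp (@measurable_rV_coord R N i)). Qed.

Lemma measurable_rV_add d (T : measurableType d) (f g : T -> 'rV[R]_N) :
  measurable_fun setT f -> measurable_fun setT g ->
  measurable_fun setT (fun z => f z + g z).
Proof.
move=> mf mg; apply: measurable_fun_rV => i; under eq_fun do rewrite mxE.
by apply: measurable_funD; exact: measurable_fun_coord.
Qed.

Lemma measurable_dotv d (T : measurableType d) (f g : T -> 'rV[R]_N) :
  measurable_fun setT f -> measurable_fun setT g ->
  measurable_fun setT (fun z => dotv (f z) (g z)).
Proof.
move=> mf mg; apply: measurable_sum => i.
by apply: measurable_funM; exact: measurable_fun_coord.
Qed.

Lemma measurable_heis_mul d (T : measurableType d) (f g : T -> V) :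
  measurable_fun setT f -> measurable_fun setT g ->
  measurable_fun setT (fun z => heis_mul (f z) (g z)).
Proof.
move=> mf mg; have := (measurable_heis_x mf, measurable_heis_y mf,
  measurable_heis_t mf, measurable_heis_x mg, measurable_heis_y mg,
  measurable_heis_t mg) => -[[[[[fx fy] ft] gx] gy] gt].
apply: measurable_fun_heis; [exact: measurable_rV_add..|].
apply: measurable_funD; first exact: measurable_funD.
apply: measurable_funM => //; apply: measurable_funB; exact: measurable_dotv.
Qed.

Lemma measurable_heis_gauge : measurable_fun setT (@heis_gauge R N).
Proof.
have mid : measurable_fun setT (@id V) by exact: measurable_id.
apply: measurable_funD; apply: measurable_funX; last exact: measurable_heis_t mid.
by apply: measurable_funD; apply: measurable_dotv;
  solve [exact: measurable_heis_x mid|exact: measurable_heis_y mid].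
Qed.

Lemma measurable_heis_norm : measurable_fun setT (@heis_norm R N).
Proof.
exact: (measurableT_comp (measurable_powR 4^-1) measurable_heis_gauge).
Qed.

Lemma measurable_heis_inv : measurable_fun setT (@heis_inv R N).
Proof.
have mid : measurable_fun setT (@id V) by exact: measurable_id.
have mN : measurable_fun setT (@GRing.opp 'rV[R]_N).
  apply: measurable_fun_rV => i; under eq_fun do rewrite mxE.
  by apply: measurable_funN; exact: measurable_rV_coord.
rewrite (_ : @heis_inv R N = fun z => (- z.1.1, - z.1.2, - z.2)); last first.
  by apply/funext => -[[x y] t].
apply: measurable_fun_heis.
- exact: (measurableT_comp mN (measurable_heis_x mid)).
- exact: (measurableT_comp mN (measurable_heis_y mid)).
- by apply: measurable_funN; exact: measurable_heis_t mid.
Qed.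

Lemma measurable_heis_ball (xi0 : V) (r : R) : measurable (heis_ball xi0 r).
Proof.
have mf : measurable_fun setT (fun eta : V => heis_norm (heis_mul (heis_inv eta) xi0)).
  apply: (measurableT_comp measurable_heis_norm).
  by apply: measurable_heis_mul => //; exact: measurable_heis_inv.
rewrite (_ : heis_ball xi0 r =
  (fun eta => heis_norm (heis_mul (heis_inv eta) xi0)) @^-1` `]-oo, r[%classic).
  exact: measurable_preimage.
by apply/seteqP; split => z /=; rewrite in_itv.
Qed.

End heis_measurability.

Section heis_invariance.
Variables (R : realType) (N : nat).
Local Notation V := (heis R N).
Local Notation mu := (@heis_measure R N).

Lemma scales_heis (a b : 'rV[R]_N) (t : R) (l : 'rV[R]_N * 'rV[R]_N -> R) :
  0 < t -> measurable_fun setT l ->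
  scales_measure mu (t^-1 ^+ (2 * N).+2)
    (fun z => (a + t *: z.1.1, b + t *: z.1.2, l z.1 + t ^+ 2 * z.2)).
Proof.
move=> t0 ml; have t10 : 0 <= t^-1 by rewrite invr_ge0 ltW.
have -> : t^-1 ^+ (2 * N).+2 = t^-1 ^+ N * t^-1 ^+ N * (t ^+ 2)^-1.
  by rewrite -exprVn -!exprD; congr (_ ^+ _); lia.
apply: (@scales_skew_product _ _ _ _ _ (lebesgue_rV R N \x lebesgue_rV R N)%E
  (@lebesgue_R R) _ _
  (fun z => (a + t *: z.1, b + t *: z.2)) (fun z s => l z + t ^+ 2 * s)).
- by rewrite mulr_ge0 ?exprn_ge0.
- by rewrite invr_ge0 exprn_ge0// ltW.
- apply: (@scales_skew_product _ _ _ _ _ (lebesgue_rV R N)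
    (lebesgue_rV R N) _ _
    (fun z => a + t *: z) (fun _ z => b + t *: z)).
  + by rewrite exprn_ge0.
  + by rewrite exprn_ge0.
  + exact: scales_lebesgue_rV.
  + exact: (measurableT_comp (measurable_fun_rV_affine _ _) measurable_snd).
  + by move=> _; exact: scales_lebesgue_rV.
- apply: measurable_funD; first exact: (measurableT_comp ml measurable_fst).
  by apply: measurable_funM => //; exact: measurable_snd.
- by move=> z; apply: scales_lebesgue_R; rewrite exprn_gt0.
Qed.

Definition preserves_measure (f : V -> V) :=
  measurable_fun setT f /\ forall A, measurable A -> mu (f @^-1` A) = mu A.

Lemma preserves_measure_shear (a b : 'rV[R]_N) (l : 'rV[R]_N * 'rV[R]_N -> R) :
  measurable_fun setT l ->
  preserves_measure (fun z => (a + z.1.1, b + z.1.2, l z.1 + z.2)).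
Proof.
move=> ml; have [mf fE] := scales_heis a b ltr01 ml.
rewrite (_ : (fun z => _) =
  (fun z => (a + 1 *: z.1.1, b + 1 *: z.1.2, l z.1 + 1 ^+ 2 * z.2))).
  by split => // A mA; rewrite fE// invr1 expr1n mul1e.
by apply/funext => z; rewrite !scale1r expr1n mul1r.
Qed.

Lemma preserves_measure_mull (zeta : V) : preserves_measure (heis_mul zeta).
Proof.
rewrite (_ : heis_mul zeta = fun z => (zeta.1.1 + z.1.1, zeta.1.2 + z.1.2,
  (zeta.2 + 2 * (dotv z.1.1 zeta.1.2 - dotv zeta.1.1 z.1.2)) + z.2)); last first.
  by apply/funext => z; rewrite /heis_mul; congr (_, _, _); ring.
apply: (@preserves_measure_shear zeta.1.1 zeta.1.2 (fun z =>
  zeta.2 + 2 * (dotv z.1 zeta.1.2 - dotv zeta.1.1 z.2))).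
apply: measurable_funD => //; apply: measurable_funM => //.
apply: measurable_funB; by apply: measurable_dotv.
Qed.

Lemma preserves_measure_mulr (zeta : V) :
  preserves_measure (fun xi => heis_mul xi zeta).
Proof.
rewrite (_ : (fun xi => _) = fun z => (zeta.1.1 + z.1.1, zeta.1.2 + z.1.2,
  (zeta.2 + 2 * (dotv zeta.1.1 z.1.2 - dotv z.1.1 zeta.1.2)) + z.2)); last first.
  apply/funext => z; rewrite /heis_mul (addrC z.1.1) (addrC z.1.2).
  by congr (_, _, _); ring.
apply: (@preserves_measure_shear zeta.1.1 zeta.1.2 (fun z =>
  zeta.2 + 2 * (dotv zeta.1.1 z.2 - dotv z.1 zeta.1.2))).
apply: measurable_funD => //; apply: measurable_funM => //.
apply: measurable_funB; by apply: measurable_dotv.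
Qed.

Lemma heis_ball_mull (zeta xi0 : V) (r : R) :
  heis_mul zeta @^-1` heis_ball (heis_mul zeta xi0) r = heis_ball xi0 r.
Proof.
apply/seteqP; split => eta; rewrite /heis_ball /= heis_invM -heis_mulA;
  by rewrite heis_mulVK.
Qed.

Lemma heis_ball0E (r : R) : heis_ball (0 : V) r = [set z | heis_norm z < r].
Proof.
by apply/seteqP; split => z; rewrite /heis_ball /= heis_mulg0 heis_normV.
Qed.

Lemma heis_measure_ball_center (xi0 : V) (r : R) :
  mu (heis_ball xi0 r) = mu (heis_ball (0 : V) r).
Proof.
have [_ H] := preserves_measure_mull (heis_inv xi0).
rewrite -(H (heis_ball (0 : V) r)); last exact: measurable_heis_ball.
by congr (mu _); rewrite -(heis_mulVg xi0) heis_ball_mull.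
Qed.

Lemma heis_measure_ball_scale (xi0 : V) (r : R) : 0 < r ->
  mu (heis_ball xi0 r) = ((r ^+ (2 * N).+2)%:E * mu (heis_ball (0%R : V) 1%R))%E.
Proof.
move=> r0; rewrite heis_measure_ball_center.
pose dil : V -> V := fun z => (0 + r^-1 *: z.1.1, 0 + r^-1 *: z.1.2, 0 + r^-1 ^+ 2 * z.2).
have [_ dE] : scales_measure mu (r^-1^-1 ^+ (2 * N).+2) dil.
  by apply: (@scales_heis 0 0 r^-1 (fun=> 0)) => //; rewrite invr_gt0.
rewrite invrK in dE; rewrite -dE; last exact: measurable_heis_ball.
congr (mu _); rewrite !heis_ball0E; apply/seteqP.
suff H z : (heis_norm (dil z) < 1) = (heis_norm z < r) by split => z; rewrite /= H.
rewrite !heis_norm_lt// expr1n -(ltr_pM2l (exprn_gt0 4 r0)) mulr1.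
congr (_ < _); rewrite /heis_gauge /dil /= !add0r !dotvE.
field; exact: lt0r_neq0.
Qed.

Lemma prode_cst (n : nat) (c : R) :
  (\big[*%E/1]_(i < n) c%:E = (c ^+ n)%:E)%E.
Proof.
by elim: n => [|n IHn]; rewrite ?big_ord0// big_ord_recl IHn exprS EFinM.
Qed.

(** Cubes are compared with the unit ball to see that it has finite, nonzero
    measure. *)
Definition cube (a : R) : set V :=
  ([set v : 'rV[R]_N | forall i, `[- a, a]%classic (v ord0 i)] `*`
  [set v : 'rV[R]_N | forall i, `[- a, a]%classic (v ord0 i)]) `*` `[- a, a].

Lemma measurable_rV_cube (a : R) :
  measurable [set v : 'rV[R]_N | forall i, `[- a, a]%classic (v ord0 i)].
Proof.
rewrite (_ : mkset _ = \bigcap_(i in [set: 'I_N])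
    (@rV_coord R N i @^-1` `[- a, a]%classic)); last first.
  by apply/seteqP; split => v /= Av i; [move=> _|]; exact: Av.
apply: fin_bigcap_measurable => // i _.
exact: measurable_preimage (@measurable_rV_coord _ _ _) _.
Qed.

Lemma measurable_cube (a : R) : measurable (cube a).
Proof.
by apply: measurableX => //; apply: measurableX; exact: measurable_rV_cube.
Qed.

Lemma heis_measure_cube (a : R) : 0 < a ->
  mu (cube a) = ((2 * a) ^+ N * (2 * a) ^+ N * (2 * a))%:E.
Proof.
move=> a0; have mB := measurable_rV_cube a.
have I : lebesgue_R `[- a, a]%classic = (2 * a)%:E.
  rewrite /lebesgue_R /pushforward preimage_id lebesgue_measure_itv /= lte_fin.
  by rewrite gtrN// -EFinD; congr EFin; ring.
rewrite /heis_measure /cube [LHS]product_measure1E//; last exact: measurableX.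
rewrite [X in (X * _)%E]product_measure1E//. 
rewrite -[X in (_ * X)%E]/(lebesgue_R `[- a, a]%classic) I EFinM EFinM; congr (_ * _)%E.
have B : lebesgue_rV R N [set v : 'rV[R]_N | forall i, `[- a, a]%classic (v ord0 i)]
    = ((2 * a) ^+ N)%:E.
  rewrite (@lebesgue_rV_box R N (fun=> `[- a, a]%classic))//.
  by rewrite -prode_cst; apply: eq_bigr => i _; exact: I.
by rewrite EFinM; congr (_ * _)%E; exact: B.
Qed.

Lemma heis_measure_unit_ball :
  (0 < mu (heis_ball (0%R : V) 1%R) /\ mu (heis_ball (0%R : V) 1%R) < +oo)%E.
Proof.
have abs1 (r b : R) : 0 <= b -> r ^+ 2 <= b ^+ 2 -> r \in `[- b, b].
  by move=> b0 rb; rewrite in_itv /= -ler_norml -(ler_pXn2r (_ : 0 < 2)%N) ?nnegrE//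
    real_normK ?num_real.
have sqr_lt1 (r : R) : 0 <= r -> r ^+ 2 < 1 -> r < 1 by move=> r0 r1;
  rewrite -(@expr_lt1 _ 2).
split.
- pose a : R := (2 * N%:R + 2)^-1.
  have n0 : (0 : R) <= N%:R by [].
  have a0 : 0 < a by rewrite invr_gt0 ltr_wpDl ?mulr_ge0.
  have aN : a * (2 * N%:R + 2) = 1 by rewrite mulVf// lt0r_neq0// ltr_wpDl ?mulr_ge0.
  apply: (@lt_le_trans _ _ (mu (cube a))).
    by rewrite heis_measure_cube// lte_fin !mulr_gt0 ?exprn_gt0 ?mulr_gt0.
  apply: le_measure; rewrite ?inE; [exact: measurable_cube|exact: measurable_heis_ball|].
  move=> -[[x y] t] [/= [xa ya] ta]; rewrite heis_ball0E /= heis_norm_lt// expr1n.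
  have cube_dotv (v : 'rV[R]_N) :
      (forall i, v ord0 i \in `[- a, a]) -> dotv v v <= N%:R * a ^+ 2.
    move=> va; have -> : N%:R * a ^+ 2 = \sum_(i < N) a ^+ 2.
      by rewrite sumr_const card_ord mulr_natl.
    apply: ler_sum => i _; rewrite -expr2 -real_normK ?num_real//.
    by rewrite ler_pXn2r ?nnegrE ?(ltW a0)// ler_norml; have := va i; rewrite in_itv.
  have Hx := cube_dotv _ xa; have Hy := cube_dotv _ ya.
  have t2 : t ^+ 2 <= a ^+ 2.
    rewrite -real_normK ?num_real// ler_pXn2r ?nnegrE ?(ltW a0)// ler_norml.
    by move: ta; rewrite in_itv.
  have z0 : 0 <= dotv x x + dotv y y by rewrite addr_ge0 ?dotvv_ge0.
  have za : dotv x x + dotv y y <= a.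
    apply: le_trans (lerD Hx Hy) _; rewrite -{3}(mulr1 a) -aN; nra.
  have zz : (dotv x x + dotv y y) ^+ 2 <= a ^+ 2 by rewrite ler_pXn2r ?nnegrE// ltW.
  have a2 : a ^+ 2 <= a / 2 by nra.
  have a1 : a <= 2^-1 by nra.
  apply: (@le_lt_trans _ _ (a ^+ 2 + a ^+ 2)); first exact: lerD.
  by move: a2 a1; lra.
- apply: (@le_lt_trans _ _ (mu (cube 1))); last first.
    by rewrite heis_measure_cube// ltry.
  apply: le_measure; rewrite ?inE; [exact: measurable_heis_ball|exact: measurable_cube|].
  move=> -[[x y] t]; rewrite heis_ball0E /= heis_norm_lt// expr1n /heis_gauge /= => g1.
  have x0 := dotvv_ge0 x; have y0 := dotvv_ge0 y.
  have z1 : dotv x x + dotv y y < 1.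
    apply: sqr_lt1; first by rewrite addr_ge0.
    by apply: le_lt_trans g1; rewrite lerDl sqr_ge0.
  split; [split|] => /= [i|i|].
  + apply: abs1 => //; rewrite expr1n; apply: le_trans (sqr_coord_le_dotvv _ _) _.
    by apply: le_trans (ltW z1); rewrite lerDl.
  + apply: abs1 => //; rewrite expr1n; apply: le_trans (sqr_coord_le_dotvv _ _) _.
    by apply: le_trans (ltW z1); rewrite lerDr.
  + apply: abs1 => //; rewrite expr1n; apply: le_trans (ltW g1).
    by rewrite lerDr sqr_ge0.
Qed.

End heis_invariance.

(** * Smooth functions *)

Section flat_functions.
Variable R : realType.
Implicit Types (p q : {poly R}) (x y : R).

(** The functions p(1/x) exp(-1/x) extended by 0 to the left of the origin. Letting
    p range over all polynomials gives a class closed under differentiation, which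
    turns smoothness into an induction; p = 1 is the classical bump profile. *)
Definition flat p x : R := if 0 < x then p.[x^-1] * expR (- x^-1) else 0.

Lemma exprn_le_expR n y : 0 <= y -> y ^+ n <= n`!%:R * expR y.
Proof.
move=> y0; have f0 : 0 < n`!%:R :> R by rewrite ltr0n fact_gt0.
rewrite mulrC -ler_pdivrMr//; case: n f0 => [|n] f0.
  by rewrite expr0 fact0 divr1; apply: le_trans (expR_ge1Dx y); rewrite lerDl.
by apply: le_trans (expR_ge1Dxn n y0); rewrite lerDr.
Qed.

Lemma poly_le_expR p : exists C : R, forall y, 0 <= y -> `|p.[y]| <= C * expR y.
Proof.
exists (\sum_(i < size p) `|p`_i| * i`!%:R) => y y0.
rewrite horner_coef; apply: le_trans (ler_norm_sum _ _ _) _.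
rewrite mulr_suml; apply: ler_sum => i _.
rewrite normrM -mulrA ler_wpM2l// ger0_norm ?exprn_ge0//.
exact: exprn_le_expR.
Qed.

Lemma flat_gt0E p x : 0 < x -> flat p x = p.[x^-1] * expR (- x^-1).
Proof. by rewrite /flat => ->. Qed.

(** For x > 0 this is the chain rule. At 0 the difference quotient is q(1/x) exp(-1/x)
    times x with q = X^2 p, and q(y) exp(-y) is bounded for y >= 0. *)
Lemma is_derive_flat p x :
  is_derive x 1 (flat p) (flat ('X ^+ 2 * (p - p^`())) x).
Proof.
case: (ltgtP x 0) => [x0|x0|->].
- rewrite {2}/flat ltNge (ltW x0)/=.
  apply: near_eq_is_derive (is_derive_cst (0 : R) x 1).
  near=> y; rewrite /flat ltNge (_ : y <= 0)//; apply: ltW.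
  near: y; exact: lt_nbhsl.
- rewrite [X in is_derive _ _ _ X]flat_gt0E//.
  apply: (@near_eq_is_derive _ _ _ (fun y => p.[y^-1] * expR (- y^-1))).
    by near=> y; rewrite flat_gt0E//; near: y; exact: lt_nbhsr.
  have xn0 : x != 0 by rewrite gt_eqF.
  have Hi : is_derive x 1 (fun y : R => y^-1) (- x ^- 2).
    apply: DeriveDef; first exact: (@derivableV _ _ id).
    by rewrite (@deriveV _ _ id)// derive_id [LHS]mulr1.
  have Hp : is_derive x 1 (horner p \o (fun y => y^-1)) (p^`().[x^-1] * (- x ^- 2)).
    have Hh : is_derive x^-1 1 (horner p) p^`().[x^-1].
      by have [H1 H2] := conj (@derivable_horner R p x^-1) (derivE p);
        apply: (DeriveDef H1); rewrite H2 derive1E.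
    exact: is_derive1_comp Hh Hi.
  have He : is_derive x 1 (expR \o (fun y => - y^-1)) (expR (- x^-1) * x ^- 2).
    by apply: is_derive1_comp; rewrite -[x ^- 2]opprK; exact: is_deriveN.
  apply: is_derive_eq (is_deriveM Hp He) _ => /=.
  rewrite !hornerE /GRing.scale /=; move: (p.[_]) (p^`().[_]) (expR _) => a b c.
  by rewrite exprVn; ring.
- rewrite {2}/flat ltxx.
  have [C HC] := poly_le_expR ('X ^+ 2 * p).
  suff H : h^-1 *: (flat p (h *: 1 + 0) - flat p 0) @[h --> 0^'] --> (0 : R).
    apply: DeriveDef; first by apply/cvg_ex; exists 0.
    exact/cvg_lim.
  have C0 : 0 <= C by have := HC 0 (lexx _); rewrite expR0 mulr1; exact: le_trans.
  have C1 : 0 < C + 1 by rewrite ltr_wpDl.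
  apply/cvgr0Pnorm_le => e e0; near=> h.
  rewrite addr0 [h *: 1]mulr1 {2}/flat ltxx subr0 /flat.
  case: ifPn => [h0|_]; last by rewrite scaler0 normr0 ltW.
  have y0 : 0 < h^-1 by rewrite invr_gt0.
  apply: (@le_trans _ _ (C * h)).
    have := HC _ (ltW y0); rewrite -ler_pdivrMr ?expR_gt0// => H.
    have -> : h^-1 *: (p.[h^-1] * expR (- h^-1)) =
       h * (('X ^+ 2 * p).[h^-1] / expR h^-1).
      by rewrite expRN !hornerE /GRing.scale /=; field; rewrite !gt_eqF ?expR_gt0.
    by rewrite normrM mulrC (gtr0_norm h0) ler_wpM2r ?(ltW h0)//
      normrM [X in _ * X]gtr0_norm ?invr_gt0 ?expR_gt0.
  apply: (@le_trans _ _ ((C + 1) * h)); first by rewrite ler_wpM2r ?(ltW h0)// lerDl.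
  rewrite mulrC -ler_pdivlMr// -(gtr0_norm h0) ltW//.
  near: h; apply: dnbhs0_lt; exact: divr_gt0.
Unshelve. all: end_near. Qed.

Lemma flat_continuous p : continuous (flat p).
Proof.
move=> x; apply/differentiable_continuous/derivable1_diffP.
by have [] := is_derive_flat p x.
Qed.

Lemma measurable_flat p : measurable_fun setT (flat p).
Proof. by apply: continuous_measurable_fun; exact: flat_continuous. Qed.

Lemma flat1_itv x : 0 <= flat 1 x < 1.
Proof.
rewrite /flat; case: ifPn => [x0|_]; last by rewrite lexx ltr01.
by rewrite -polyC1 hornerC mul1r expR_ge0 expR_lt1 oppr_lt0 invr_gt0.
Qed.

Lemma flat1_gt0 x : (0 < flat 1 x) = (0 < x).
Proof.
rewrite /flat; case: ifPn => [x0|]; last by rewrite ltxx.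
by rewrite -polyC1 hornerC mul1r expR_gt0.
Qed.

End flat_functions.

Section smooth_functions.
Variables (R : realType) (N : nat).
Local Notation V := (heis R N).
Implicit Types (f g : V -> R).

(** Besides derivatives along all directions, differentiability is required, so
    that the derivative is linear in the direction, and measurability, because the
    sigma-algebra is generated by the coordinates and not by the topology. Both
    are inherited by sums, products and compositions. *)
Fixpoint smooth (k : nat) f : Prop :=
  [/\ forall x, differentiable f x, measurable_fun setT f &
      if k is m.+1 then forall v, smooth m (fun x => 'D_v f x) else True].

Lemma smooth_differentiable k f : smooth k f -> forall x, differentiable f x.
Proof. by case: k => [|k] []. Qed.

Lemma smooth_measurable k f : smooth k f -> measurable_fun setT f.
Proof. by case: k => [|k] []. Qed.

Lemma smooth_derive k f v : smooth k.+1 f -> smooth k (fun x => 'D_v f x).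
Proof. by case=> _ _; exact. Qed.

Lemma smooth_pred k f : smooth k.+1 f -> smooth k f.
Proof.
elim: k f => [|k IHk] f [df mf Df]; split=> // v.
by apply: IHk; exact: Df.
Qed.

Lemma smooth_continuous k f : smooth k f -> continuous f.
Proof.
by move=> /smooth_differentiable df x; exact: differentiable_continuous.
Qed.

Lemma smooth_Ck k f : smooth k f -> Ck k f.
Proof.
elim: k f => [|k IHk] f sf.
  by split=> //; exact: smooth_continuous sf.
split; first exact: smooth_continuous sf.
move=> v; split=> [x|]; first exact/diff_derivable/smooth_differentiable/sf.
by apply: IHk; exact: smooth_derive.
Qed.

Lemma eq_smooth k f g : g =1 f -> smooth k f -> smooth k g.
Proof. by move=> /funext ->. Qed.

Lemma smooth_cst k (c : R) : smooth k (fun=> c).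
Proof.
elim: k c => [|k IHk] c; split=> // v.
apply: (@eq_smooth _ (fun=> 0)); last exact: IHk.
by move=> x; rewrite derive_cst.
Qed.

Lemma smoothD k f g : smooth k f -> smooth k g -> smooth k (fun x => f x + g x).
Proof.
elim: k f g => [|k IHk] f g sf sg.
  split=> //; last exact: measurable_funD (smooth_measurable sf) (smooth_measurable sg).
  by move=> x; apply: differentiableD; [exact: smooth_differentiable sf x|
    exact: smooth_differentiable sg x].
split; [| |move=> v].
- by move=> x; apply: differentiableD; [exact: smooth_differentiable sf x|
    exact: smooth_differentiable sg x].
- exact: measurable_funD (smooth_measurable sf) (smooth_measurable sg).
- apply: (@eq_smooth _ (fun x => 'D_v f x + 'D_v g x)); last first.
    by apply: IHk; exact: smooth_derive.
  move=> x; rewrite deriveD//; apply: diff_derivable.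
    exact: smooth_differentiable sf x.
  exact: smooth_differentiable sg x.
Qed.

Lemma smoothM k f g : smooth k f -> smooth k g -> smooth k (fun x => f x * g x).
Proof.
elim: k f g => [|k IHk] f g sf sg.
  split=> //; last exact: measurable_funM (smooth_measurable sf) (smooth_measurable sg).
  by move=> x; apply: differentiableM; [exact: smooth_differentiable sf x|
    exact: smooth_differentiable sg x].
split; [| |move=> v].
- by move=> x; apply: differentiableM; [exact: smooth_differentiable sf x|
    exact: smooth_differentiable sg x].
- exact: measurable_funM (smooth_measurable sf) (smooth_measurable sg).
- apply: (@eq_smooth _ (fun x => f x * 'D_v g x + g x * 'D_v f x)); last first.
    by apply: smoothD; apply: IHk; solve [exact: smooth_pred|exact: smooth_derive].
  move=> x; rewrite deriveM//; apply: diff_derivable.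
    exact: smooth_differentiable sf x.
  exact: smooth_differentiable sg x.
Qed.

Lemma smoothN k f : smooth k f -> smooth k (fun x => - f x).
Proof.
move=> sf; have := smoothM (smooth_cst k (-1)) sf.
by congr smooth; apply/funext => x; rewrite mulN1r.
Qed.

Lemma smoothB k f g : smooth k f -> smooth k g -> smooth k (fun x => f x - g x).
Proof. by move=> sf sg; apply: smoothD => //; exact: smoothN. Qed.

Lemma smoothX k f n : smooth k f -> smooth k (fun x => f x ^+ n).
Proof.
move=> sf; elim: n => [|n IHn].
  by apply: (@eq_smooth _ (fun=> 1)); [move=> x; rewrite expr0|exact: smooth_cst].
apply: (@eq_smooth _ (fun x => f x * f x ^+ n)); last exact: smoothM.
by move=> x; rewrite exprS.
Qed.

Lemma smooth_sum k n (F : 'I_n -> V -> R) :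
  (forall i, smooth k (F i)) -> smooth k (fun x => \sum_(i < n) F i x).
Proof.
move=> sF; elim: n F sF => [|n IHn] F sF.
  by apply: (@eq_smooth _ (fun=> 0)); [move=> x; rewrite big_ord0|exact: smooth_cst].
apply: (@eq_smooth _ (fun x => F ord0 x + \sum_(i < n) F (lift ord0 i) x)).
  by move=> x; rewrite big_ord_recl.
by apply: smoothD => //; exact: IHn.
Qed.

Lemma derive_linear f (x v : V) :
  (forall h y, f (h *: v + y) = h * f v + f y) -> 'D_v f x = f v.
Proof.
move=> fE; rewrite /derive; apply: lim_near_cst => //; near=> h.
rewrite /= fE addrK [LHS]mulrA mulVf ?mul1r//.
near: h; exact: nbhs_dnbhs_neq.
Unshelve. all: end_near. Qed.

Lemma smooth_linear k f : (forall x, differentiable f x) -> measurable_fun setT f ->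
  (forall h (v y : V), f (h *: v + y) = h * f v + f y) -> smooth k f.
Proof.
move=> df mf fE; case: k => [|k]; split=> // v.
apply: (@eq_smooth _ (fun=> f v)); last exact: smooth_cst.
by move=> x; exact: derive_linear.
Qed.

Lemma smooth_x k i : smooth k (fun z : V => z.1.1 ord0 i).
Proof.
apply: smooth_linear.
- move=> x; apply: (@differentiable_comp _ _ _ _ (fun z : V => z.1.1)
    (fun v : 'rV[R]_N => v ord0 i)); last exact: differentiable_coord.
  apply: (@differentiable_comp _ _ _ _ (@fst ('rV[R]_N * 'rV[R]_N) R) (@fst 'rV[R]_N
    'rV[R]_N)).
    by apply: linear_differentiable => y; exact: cvg_fst.
  by apply: linear_differentiable => y; exact: cvg_fst.
- by apply: measurable_fun_coord; apply: measurable_heis_x; exact: measurable_id.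
- by move=> h v y; rewrite /= !mxE.
Qed.

Lemma smooth_y k i : smooth k (fun z : V => z.1.2 ord0 i).
Proof.
apply: smooth_linear.
- move=> x; apply: (@differentiable_comp _ _ _ _ (fun z : V => z.1.2)
    (fun v : 'rV[R]_N => v ord0 i)); last exact: differentiable_coord.
  apply: (@differentiable_comp _ _ _ _ (@fst ('rV[R]_N * 'rV[R]_N) R) (@snd 'rV[R]_N
    'rV[R]_N)).
    by apply: linear_differentiable => y; exact: cvg_fst.
  by apply: linear_differentiable => y; exact: cvg_snd.
- by apply: measurable_fun_coord; apply: measurable_heis_y; exact: measurable_id.
- by move=> h v y; rewrite /= !mxE.
Qed.

Lemma smooth_t k : smooth k (fun z : V => z.2).
Proof.
apply: smooth_linear.
- by move=> x; apply: linear_differentiable => y; exact: cvg_snd.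
- exact: measurable_snd.
- by [].
Qed.

Lemma derive_flat_comp p f (x v : V) : differentiable f x ->
  'D_v (fun x => flat p (f x)) x = flat ('X ^+ 2 * (p - p^`())) (f x) * 'D_v f x.
Proof.
move=> df; have dp := is_derive_flat p (f x).
have dfp : differentiable (flat p) (f x) by apply/derivable1_diffP; case: dp.
rewrite deriveE; last exact: (differentiable_comp (g := flat p)).
rewrite (diff_comp (g := flat p))// /= [in RHS]deriveE//.
have [_ <-] := dp.
by rewrite deriveE// -[X in 'd _ _ X]mulr1 [LHS]linearZ mulrC.
Qed.

Lemma smooth_flat k p f : smooth k f -> smooth k (fun x => flat p (f x)).
Proof.
have df1 q g x : differentiable g x -> differentiable (fun x : V => flat q (g x)) x.
  move=> dg; apply: (differentiable_comp (g := flat q)) => //.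
  by apply/derivable1_diffP; case: (is_derive_flat q (g x)).
elim: k p f => [|k IHk] p f sf.
  split=> // [x|]; first exact: df1 (smooth_differentiable sf x).
  exact: (measurableT_comp (measurable_flat p) (smooth_measurable sf)).
split=> [x||v]; first exact: df1 (smooth_differentiable sf x).
  exact: (measurableT_comp (measurable_flat p) (smooth_measurable sf)).
apply: (@eq_smooth _ (fun x => flat ('X ^+ 2 * (p - p^`())) (f x) * 'D_v f x));
  last first.
  by apply: smoothM; [apply: IHk; exact: smooth_pred|exact: smooth_derive].
by move=> x; rewrite derive_flat_comp//; exact: smooth_differentiable sf x.
Qed.

(** Precomposition with an affine map only changes the direction of derivation by
    the linear part. *)
Lemma derive_affine_comp (A L : V -> V) f (x v : V) :
  (forall h v y, A (h *: v + y) = h *: L v + A y) ->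
  'D_v (fun x => f (A x)) x = 'D_(L v) f (A x).
Proof.
move=> AE; rewrite /derive.
suff -> : (fun h => h^-1 *: (((fun x => f (A x)) \o shift x) (h *: v) - f (A x))) =
  (fun h => h^-1 *: ((f \o shift (A x)) (h *: L v) - f (A x))) by [].
by apply/funext => h /=; rewrite AE.
Qed.

Lemma smooth_affine_comp k (A L : V -> V) f :
  (forall x, differentiable A x) -> measurable_fun setT A ->
  (forall h v y, A (h *: v + y) = h *: L v + A y) ->
  smooth k f -> smooth k (fun x => f (A x)).
Proof.
move=> dA mA AE; elim: k f => [|k IHk] f sf.
  split=> // [x|]; last exact: measurableT_comp (smooth_measurable sf) mA.
  by apply: (differentiable_comp (g := f)) => //; exact: smooth_differentiable sf _.
split=> [x||v]; last 2 first.
- exact: measurableT_comp (smooth_measurable sf) mA.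
- apply: (@eq_smooth _ (fun x => 'D_(L v) f (A x))).
    by move=> x; exact: derive_affine_comp.
  by apply: (IHk (fun y => 'D_(L v) f y)); exact: smooth_derive.
- by apply: (differentiable_comp (g := f)) => //; exact: smooth_differentiable sf _.
Qed.

End smooth_functions.

(** * Smooth functions compute L^1 norms *)

Section borel_generation.
Variables (R : realType) (N : nat).
Local Notation V := (heis R N).
Variable G : set (set V).
Hypothesis sG : sigma_algebra setT G.

Lemma preimage_R_ind (f : V -> R) : (forall a, G [set z | a < f z]) ->
  forall B, measurable B -> G (f @^-1` B).
Proof.
move=> Gf B; rewrite -[X in G X]setTI -[measurable B]/((@ocitv R).-sigma.-measurable B).
rewrite RGenOInfty.measurableE; move: B.
apply: (@smallest_sub _ _ _ (image_set_system setT f G)).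
  exact: sigma_algebra_image.
move=> _ [a ->]; rewrite /image_set_system /= setTI.
rewrite (_ : _ @^-1` _ = [set z | a < f z])//.
by apply/seteqP; split => z /=; rewrite in_itv /= andbT.
Qed.

Lemma preimage_rV_ind (f : V -> 'rV[R]_N) :
  (forall i a, G [set z | a < f z ord0 i]) ->
  forall B, measurable B -> G (f @^-1` B).
Proof.
move=> Gf B; rewrite -[X in G X]setTI; move: B.
apply: (@smallest_sub _ _ _ (image_set_system setT f G)).
  exact: sigma_algebra_image.
move=> B; rewrite -bigcup_seq /= => -[i _ [C mC <-]].
rewrite /image_set_system /= setTI preimage_setI preimage_setT setTI.
exact: (preimage_R_ind (Gf i)).
Qed.

Lemma preimage_prod_ind d1 d2 (T1 : measurableType d1) (T2 : measurableType d2)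
    (f : V -> T1) (g : V -> T2) :
  (forall B, measurable B -> G (f @^-1` B)) ->
  (forall B, measurable B -> G (g @^-1` B)) ->
  forall B, measurable B -> G ((fun z => (f z, g z)) @^-1` B).
Proof.
move=> Gf Gg B; rewrite -[X in G X]setTI; move: B.
apply: (@smallest_sub _ _ _ (image_set_system setT (fun z => (f z, g z)) G)).
  exact: sigma_algebra_image.
by move=> B [] [C mC <-]; rewrite /image_set_system /= setTI preimage_setI
  preimage_setT setTI -comp_preimage; [exact: Gf|exact: Gg].
Qed.

Lemma heis_measurable_ind :
  (forall i a, G [set z : V | a < z.1.1 ord0 i]) ->
  (forall i a, G [set z : V | a < z.1.2 ord0 i]) ->
  (forall a, G [set z : V | a < z.2]) ->
  forall A : set V, measurable A -> G A.
Proof.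
move=> Gx Gy Gt A mA.
have H := @preimage_prod_ind _ _ _ _ (fun z : V => (z.1.1, z.1.2)) (fun z => z.2).
rewrite (_ : A = (fun z : V => (z.1.1, z.1.2, z.2)) @^-1` A).
  apply: H => //; last exact: preimage_R_ind.
  by apply: preimage_prod_ind; exact: preimage_rV_ind.
by apply/seteqP; split => -[[]].
Qed.

End borel_generation.

Section plateaus.
Variables (R : realType) (N : nat).
Local Notation V := (heis R N).

Definition unit_smooth (psi : V -> R) :=
  (forall k, smooth k psi) /\ forall x, 0 <= psi x <= 1.

(** As n grows these smooth functions increase to the indicator function of
    {f > 0}, since 1 - flat 1 (f x) is less than 1 exactly there. They vanish off
    this set. *)
Definition plateau (f : V -> R) (n : nat) (x : V) : R :=
  1 - (1 - flat 1 (f x)) ^+ n.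

Lemma unit_smooth_plateau f n : (forall k, smooth k f) -> unit_smooth (plateau f n).
Proof.
move=> sf; split=> [k|x].
  apply: smoothB; first exact: smooth_cst.
  apply: smoothX; apply: smoothB; first exact: smooth_cst.
  exact: smooth_flat.
have /andP[t0 t1] := flat1_itv (f x).
rewrite /plateau subr_ge0 exprn_ile1 ?subr_ge0 ?(ltW t1)//=;
  last by rewrite lerBlDr lerDl.
by rewrite lerBlDr lerDl exprn_ge0// subr_ge0 ltW.
Qed.

Lemma plateau_out f n x : f x <= 0 -> plateau f n x = 0.
Proof. by move=> fx; rewrite /plateau /flat ltNge fx /= subr0 expr1n subrr. Qed.

Lemma cvg_plateau f x : plateau f n x @[n --> \oo] --> (\1_[set x | 0 < f x] x : R).
Proof.
rewrite indicE; have [fx|fx] := ltP 0 (f x).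
  rewrite mem_set//= -[X in _ --> X]subr0; apply: cvgB; first exact: cvg_cst.
  apply: cvg_expr; have /andP[t0 t1] := flat1_itv (f x).
  by rewrite gtr0_norm ?subr_gt0// ltrBlDr ltrDl flat1_gt0.
rewrite memNset /=; last by apply/negP; rewrite -leNgt.
rewrite (_ : (fun n => _) = fun=> 0); first exact: cvg_cst.
by apply/funext => n; exact: plateau_out.
Qed.

End plateaus.

Section smooth_density.
Variables (R : realType) (N : nat).
Local Notation V := (heis R N).
Local Notation mu := (@heis_measure R N).
Variable F : V -> R.
Hypothesis intF : mu.-integrable setT (EFin \o F).

Let mF : measurable_fun setT F.
Proof. by apply/measurable_EFinP; exact: measurable_int intF. Qed.

Let defect (A : set V) (psi : V -> R) : \bar R :=
  (\int[mu]_x `|F x * (\1_A x - psi x)|%:E)%E.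

(** Sets whose indicator function is a limit of smooth functions with values in
   [0, 1], in L^1 of the measure |F| dmu. They form a sigma-algebra, and it
   contains the half-spaces. *)
Let smooth_approximable (A : set V) := measurable A /\ forall e : R, 0 < e ->
  exists2 psi, unit_smooth psi & (defect A psi <= e%:E)%E.

Let measurable_defect (A : set V) (psi : V -> R) : measurable A -> measurable_fun setT
  psi ->
  measurable_fun setT (fun x => `|F x * (\1_A x - psi x)|%:E).
Proof.
move=> mA mpsi; apply/measurable_EFinP/measurableT_comp => //.
by apply: measurable_funM => //; apply: measurable_funB => //; exact: measurable_indic.
Qed.

Let defect_cvg (A : set V) (g : nat -> V -> R) : measurable A ->
  (forall n, measurable_fun setT (g n)) -> (forall n x, 0 <= g n x <= 1) ->
  (forall x, g n x @[n --> \oo] --> (\1_A x : R)) ->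
  forall e : R, 0 < e -> exists n, (defect A (g n) <= e%:E)%E.
Proof.
move=> mA mg g01 gA e e0.
have [|||||_ _ H] := @dominated_convergence _ _ _ mu setT measurableT
  (fun n (x : V) => `|F x * (\1_A x - g n x)|%:E) (fun=> 0%E) (fun x : V => `|F x|%:E).
- by move=> n; exact: measurable_defect.
- exact: measurable_cst.
- apply: aeW => x _; apply: cvg_EFin; first exact: nearW.
  rewrite -[X in _ --> X](@normr0 R R) -[X in `|X|](mulr0 (F x)) -[X in _ * X](subrr
    (\1_A x)).
  by apply: cvg_norm; apply: cvgM; [exact: cvg_cst|apply: cvgB;
    [exact: cvg_cst|exact: gA]].
- exact: integrable_abse intF.
- apply: aeW => x n _; rewrite abse_EFin normr_id lee_fin normrM ler_piMr//.
  have /andP[g0 g1] := g01 n x.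
  by rewrite indicE; case: (x \in A) => /=; rewrite ler_norml; apply/andP; split; lra.
move: H; rewrite integral0 => /fine_cvgP[Hfin /cvgr0Pnorm_le/(_ _ e0) Hle].
near \oo => n; exists n.
have Hf : (\int[mu]_x `|F x * (\1_A x - g n x)|%:E)%E \is a fin_num by near: n.
have He : `|fine (\int[mu]_x `|F x * (\1_A x - g n x)|%:E)%E| <= e by near: n.
by rewrite /defect -(fineK Hf) lee_fin; move: He; rewrite ler_norml => /andP[].
Unshelve. all: end_near. Qed.

Let defectD (A1 A2 B : set V) (psi1 psi2 psi : V -> R) : measurable A1 -> measurable A2
  -> measurable B ->
  measurable_fun setT psi1 -> measurable_fun setT psi2 -> measurable_fun setT psi ->
  (forall x, `|\1_B x - psi x| <= `|\1_A1 x - psi1 x| + `|\1_A2 x - psi2 x|) ->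
  (defect B psi <= defect A1 psi1 + defect A2 psi2)%E.
Proof.
move=> mA1 mA2 mB m1 m2 m H; rewrite /defect -ge0_integralD//;
  try exact: measurable_defect.
apply: ge0_le_integral => //; try exact: measurable_defect.
  by apply: emeasurable_funD; exact: measurable_defect.
by move=> x _; rewrite -EFinD lee_fin !normrM -mulrDr ler_wpM2l.
Qed.

Let approximable_setU A B :
  smooth_approximable A -> smooth_approximable B -> smooth_approximable (A `|` B).
Proof.
move=> [mA HA] [mB HB]; split; first exact: measurableU.
move=> e e0; have e20 : 0 < e / 2 by rewrite divr_gt0.
have [psi [spsi psi01] HpA] := HA _ e20; have [phi [sphi phi01] HpB] := HB _ e20.
exists (fun x => 1 - (1 - psi x) * (1 - phi x)).
  split=> [k|x].
    by apply: smoothB; [exact: smooth_cst|apply: smoothM; apply: smoothB => //;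
      exact: smooth_cst].
  have /andP[? ?] := psi01 x; have /andP[? ?] := phi01 x; apply/andP; split; nra.
have mpsi := smooth_measurable (spsi 0%N); have mphi := smooth_measurable (sphi 0%N).
rewrite [e]splitr EFinD; apply: le_trans (leeD HpA HpB).
apply: defectD => //; first exact: measurableU.
  by apply: measurable_funB => //; apply: measurable_funM; exact: measurable_funB.
move=> x; have /andP[p0 p1] := psi01 x; have /andP[q0 q1] := phi01 x.
rewrite !indicE in_setU; case: (x \in A); case: (x \in B) => /=;
  rewrite ?subr0 ?sub0r ?normrN ?[`|1 - psi x|]ger0_norm ?[`|1 - phi x|]ger0_norm
    ?[`|psi x|]ger0_norm ?[`|phi x|]ger0_norm ?subr_ge0// ler_norml;
  apply/andP; split; nra.
Qed.

Let approximable_sigma_algebra : sigma_algebra setT smooth_approximable.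
Proof.
split.
- split=> // e e0; exists (fun=> 0).
    by split=> [k|x]; [exact: smooth_cst|rewrite lexx ler01].
  rewrite /defect (eq_integral (fun=> 0%E)) ?integral0 ?lee_fin ?ltW// => x _.
  by rewrite indic0 subr0 mulr0 normr0.
- move=> A [mA HA]; split; first exact: measurableD.
  move=> e /HA[psi [spsi psi01] Hpsi]; exists (fun x => 1 - psi x).
    split=> [k|x]; first by apply: smoothB => //; exact: smooth_cst.
    by have /andP[? ?] := psi01 x; apply/andP; split; lra.
  rewrite /defect (eq_integral (fun x => `|F x * (\1_A x - psi x)|%:E))// => x _.
  rewrite setTD !indicE in_setC !normrM; congr (_ * _)%:E.
  by case: (x \in A) => /=; rewrite -normrN; congr `|_|; ring.
- move=> A HA.
  pose U n := \big[setU/set0]_(k < n) A k.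
  have HU n : smooth_approximable (U n).
    rewrite /U; elim: n => [|n IHn]; last by rewrite big_ord_recr;
      exact: approximable_setU.
    rewrite big_ord0; split=> // e e0; exists (fun=> 0).
      by split=> [k|x]; [exact: smooth_cst|rewrite lexx ler01].
    rewrite /defect (eq_integral (fun=> 0%E)) ?integral0 ?lee_fin ?ltW// => x _.
    by rewrite indic0 subr0 mulr0 normr0.
  have mUA : measurable (\bigcup_k A k) by apply: bigcup_measurable => k _; case: (HA k).
  split=> // e e0; have e20 : 0 < e / 2 by rewrite divr_gt0.
  have [n Hn] : exists n, (defect (\bigcup_k A k) (\1_(U n)) <= (e / 2)%:E)%E.
    apply: (defect_cvg (g := fun n => \1_(U n))) => //.
    + by move=> n; apply: measurable_indic; case: (HU n).
    + by move=> n x; rewrite indicE; case: (_ \in _); rewrite /= ?lexx ?ler01.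
    + move=> x; apply: cvg_near_cst.
      have [[m _ Amx]|nAx] := pselect ((\bigcup_k A k) x).
        near=> n.
        have xA : (\bigcup_k A k) x by exists m.
        have xU : U n x.
          by rewrite /U -bigcup_mkord; exists m => //=; near: n; exists m.+1.
        by rewrite !indicE !mem_set.
      apply: nearW => n; rewrite !indicE !memNset// /U -bigcup_mkord => -[m _ Amx].
      by apply: nAx; exists m.
  have [mU HUe] := HU n; have [psi [spsi psi01] Hpsi] := HUe _ e20.
  exists psi => //; rewrite [e]splitr EFinD; apply: le_trans (leeD Hn Hpsi).
  have mpsi := smooth_measurable (spsi 0%N).
  apply: defectD => // x.
  by rewrite -[X in `|X|](subrKA (\1_(U n) x)) ler_normD.
Unshelve. all: end_near. Qed.

Let approximable_superlevel (f : V -> R) (a : R) :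
  (forall k, smooth k f) -> smooth_approximable [set z | a < f z].
Proof.
move=> sf; have sfa l : smooth l (fun z => f z - a).
  by apply: smoothB => //; exact: smooth_cst.
have AE : [set z | a < f z] = [set z | 0 < f z - a].
  by apply/seteqP; split => z /=; rewrite subr_gt0.
have mA : measurable [set z | 0 < f z - a].
  exact: measurable_gt (smooth_measurable (sfa 0%N)).
rewrite AE; split=> // e e0.
have us n := unit_smooth_plateau n sfa.
have [|||n Hn] := @defect_cvg _ (plateau (fun z => f z - a)) mA _ _ _ e e0.
- by move=> n; exact: smooth_measurable ((us n).1 0%N).
- by move=> n; exact: (us n).2.
- by move=> x; exact: cvg_plateau.
- by exists (plateau (fun z => f z - a) n).
Qed.

(** The sign of F is 2 1_A - 1 with A = {F > 0}; replace 1_A by a smooth psi that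
    is close to it in L^1 of |F| dmu. *)
Lemma integral_abs_le_smooth (M : R) :
  (forall phi : V -> R, (forall k, smooth k phi) -> (forall x, `|phi x| <= 1) ->
     (\int[mu]_x (F x * phi x)%:E <= M%:E)%E) ->
  (\int[mu]_x `|F x|%:E <= M%:E)%E.
Proof.
move=> HM; apply/lee_addgt0Pr => e e0.
pose A := [set x | 0 < F x].
have mA : measurable A by exact: measurable_gt.
have [_ /(_ (e / 2))[|psi [spsi psi01] Hpsi]] : smooth_approximable A.
- apply: heis_measurable_ind mA; first exact: approximable_sigma_algebra.
  + by move=> i a; apply: approximable_superlevel => k; exact: smooth_x.
  + by move=> i a; apply: approximable_superlevel => k; exact: smooth_y.
  + by move=> a; apply: approximable_superlevel => k; exact: smooth_t.
- by rewrite divr_gt0.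
pose phi x := 2 * psi x - 1.
have sphi k : smooth k phi.
  by apply: smoothB; [apply: smoothM => //|]; exact: smooth_cst.
have phi1 x : `|phi x| <= 1.
  by have /andP[? ?] := psi01 x; rewrite ler_norml /phi; apply/andP; split; lra.
have mpsi := smooth_measurable (spsi 0%N); have mphi := smooth_measurable (sphi 0%N).
have iFphi : mu.-integrable setT (fun x => (F x * phi x)%:E).
  apply: le_integrable intF => //; first exact/measurable_EFinP/measurable_funM.
  by move=> x _; rewrite !abse_EFin lee_fin normrM ler_piMr.
have id : mu.-integrable setT (fun x => (2 * `|F x * (\1_A x - psi x)|)%:E).
  have i1 : mu.-integrable setT (fun x => `|F x * (\1_A x - psi x)|%:E).
    apply: le_integrable intF => //; first exact: measurable_defect.
    move=> x _; rewrite !abse_EFin lee_fin normr_id normrM ler_piMr//.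
    have /andP[g0 g1] := psi01 x.
    by rewrite indicE; case: (x \in A) => /=; rewrite ler_norml; apply/andP; split; lra.
  by under eq_fun do rewrite EFinM; exact: integrableZl.
apply: (@le_trans _ _ (\int[mu]_x ((F x * phi x)%:E + (2 * `|F x * (\1_A x - psi
  x)|)%:E)))%E.
  apply: le_integral => //; [exact: integrable_abse intF|exact: integrableD|].
  move=> x _; rewrite -EFinD lee_fin /phi.
  have [H|H] := ltP 0 (F x).
    rewrite indicE mem_set//= (ger0_norm (ltW H)).
    have := ler_norm (F x * (1 - psi x)); lra.
  rewrite indicE memNset/=; last by apply/negP; rewrite -leNgt.
  rewrite (ler0_norm H); have := ler_norm (F x * (0 - psi x)); lra.
rewrite integralD//; apply: leeD; first exact: HM.
under eq_integral do rewrite EFinM.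
rewrite ge0_integralZl//; last exact: measurable_defect.
rewrite [leRHS](_ : _ = 2%:E * (e / 2)%:E)%E; last by rewrite -EFinM; congr EFin; field.
by rewrite lee_pmul2l.
Qed.

End smooth_density.

(** * Flows of the horizontal fields *)

Section change_of_variables.
Variables (R : realType) (N : nat).
Local Notation V := (heis R N).
Local Notation mu := (@heis_measure R N).

Lemma preserves_ge0_integral (f : V -> V) (h : V -> \bar R) :
  preserves_measure f -> measurable_fun setT h -> (forall x, 0 <= h x)%E ->
  (\int[mu]_x h (f x) = \int[mu]_x h x)%E.
Proof.
move=> [mf fE] mh h0.
have := ge0_integral_pushforward mf mu measurableT mh (fun x _ => h0 x).
rewrite preimage_setT => <-.
by rewrite [LHS](eq_measure_integral mu) => [//|A mA _]; exact: fE.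
Qed.

Lemma preserves_integrable (f : V -> V) (h : V -> R) :
  preserves_measure f -> mu.-integrable setT (EFin \o h) ->
  mu.-integrable setT (fun x => (h (f x))%:E).
Proof.
move=> pf /integrableP[mh fh]; apply/integrableP; split.
  exact: (measurableT_comp mh pf.1).
rewrite (preserves_ge0_integral (h := fun x => `|(h x)%:E|%E) pf)//.
exact: measurableT_comp.
Qed.

Lemma preserves_integral (f : V -> V) (h : V -> R) :
  preserves_measure f -> mu.-integrable setT (EFin \o h) ->
  (\int[mu]_x (h (f x))%:E = \int[mu]_x (h x)%:E)%E.
Proof.
move=> pf /measurable_int mh; rewrite [LHS]integralE [RHS]integralE; congr (_ - _)%E.
- have H := @preserves_ge0_integral f (EFin \o h)^\+%E pf
    (measurable_funepos mh) (fun x => funepos_ge0 _ x).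
  by rewrite -[RHS]H; apply: eq_integral => x _; rewrite !funeposE.
- have H := @preserves_ge0_integral f (EFin \o h)^\-%E pf
    (measurable_funeneg mh) (fun x => funeneg_ge0 _ x).
  by rewrite -[RHS]H; apply: eq_integral => x _; rewrite !funenegE.
Qed.

End change_of_variables.

Section horizontal_flows.
Variables (R : realType) (N : nat).
Local Notation V := (heis R N).
Local Notation mu := (@heis_measure R N).
Implicit Types (d : bool * 'I_N) (xi : V) (phi : V -> R).

(** A direction d is a pair: true stands for the X fields, false for the Y fields. *)
Definition hdir d : V := if d.1 then dx R d.2 else dy R d.2.

Definition hcoef d xi : R :=
  if d.1 then 2 * xi.1.2 ord0 d.2 else - (2 * xi.1.1 ord0 d.2).

Definition hfield d xi : V := hdir d + hcoef d xi *: dT R N.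

Definition hder d phi xi : R :=
  if d.1 then heis_X d.2 phi xi else heis_Y d.2 phi xi.

Definition flow d (t : R) xi : V := xi + t *: hfield d xi.

(** The integral curves of a left invariant field are right translations by a
    one-parameter group. They are straight lines because the coefficient of the
    vertical direction is constant along them. *)
Lemma flowE d t xi : flow d t xi = heis_mul xi (t *: hdir d).
Proof.
case: d => -[] i; rewrite /flow /hfield /hdir /hcoef /heis_mul /dT /=.
  congr (_, _, _); rewrite /= !(scaler0, addr0, add0r)//.
  by rewrite !dotvE dotv_delta_l subr0 /GRing.scale /=; ring.
congr (_, _, _); rewrite /= !(scaler0, addr0, add0r)//.
by rewrite !dotvE dotv_delta_r sub0r /GRing.scale /=; ring.
Qed.

Lemma hfield_flow d t xi : hfield d (flow d t xi) = hfield d xi.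
Proof.
rewrite /hfield; congr (_ + _ *: _).
case: d => -[] i; rewrite /flow /hfield /hdir /hcoef /dT /= !mxE !(mulr0, addr0)//.
Qed.

Lemma flowD d s t xi : flow d s (flow d t xi) = flow d (s + t) xi.
Proof. by rewrite {1}/flow hfield_flow /flow scalerDl addrAC addrA. Qed.

Lemma flow0 d xi : flow d 0 xi = xi.
Proof. by rewrite /flow scale0r addr0. Qed.

Lemma flowK d t : cancel (flow d t) (flow d (- t)).
Proof. by move=> xi; rewrite flowD addNr flow0. Qed.

Lemma preserves_flow d t : preserves_measure (flow d t).
Proof.
rewrite (_ : flow d t = fun xi => heis_mul xi (t *: hdir d)).
  exact: preserves_measure_mulr.
by apply/funext => xi; exact: flowE.
Qed.

Lemma heis_norm_hdir d (t : R) : heis_norm (t *: hdir d) = `|t|.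
Proof.
have : heis_norm (t *: hdir d) ^+ 4 = `|t| ^+ 4.
  rewrite heis_norm_pow4 /heis_gauge; case: d => -[] i; rewrite /hdir /=;
  rewrite !dotvE dotv_delta_l mxE !eqxx /= /GRing.scale /=.
    have -> : `|t| ^+ 4 = t ^+ 4 by rewrite -normrX ger0_norm// exprn_even_ge0.
    ring.
  have -> : `|t| ^+ 4 = t ^+ 4 by rewrite -normrX ger0_norm// exprn_even_ge0.
  ring.
by move/eqP; rewrite eqrXn2 ?heis_norm_ge0// => /eqP.
Qed.

Lemma derive_dirDZ phi xi (v w : V) (c : R) : differentiable phi xi ->
  'D_(v + c *: w) phi xi = 'D_v phi xi + c * 'D_w phi xi.
Proof. by move=> dphi; rewrite !deriveE// linearD linearZ. Qed.

Lemma hderE d phi xi : differentiable phi xi -> hder d phi xi = 'D_(hfield d xi) phi xi.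
Proof.
move=> dphi; rewrite /hder /heis_X /heis_Y /hfield /hdir /hcoef.
rewrite derive_dirDZ//.
by case: d => -[] i; rewrite /= ?mulNr.
Qed.

Lemma smooth_hcoef k d : smooth k (hcoef d).
Proof.
rewrite /hcoef; case: d => -[] i /=.
  by apply: smoothM; [exact: smooth_cst|exact: smooth_y].
by apply: smoothN; apply: smoothM; [exact: smooth_cst|exact: smooth_x].
Qed.

Lemma smooth_hder k d phi : smooth k.+1 phi -> smooth k (hder d phi).
Proof.
move=> sphi; apply: (@eq_smooth _ _ _
  (fun xi => 'D_(hdir d) phi xi + hcoef d xi * 'D_(dT R N) phi xi)); last first.
  apply: smoothD; first exact: smooth_derive.
  by apply: smoothM; [exact: smooth_hcoef|exact: smooth_derive].
move=> xi; have dphi := smooth_differentiable sphi xi.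
by rewrite hderE// derive_dirDZ.
Qed.

Lemma is_derive_flow d phi xi (s : R) : (forall x, differentiable phi x) ->
  is_derive s 1 (fun s => phi (flow d s xi)) (hder d phi (flow d s xi)).
Proof.
move=> dphi; rewrite hderE// hfield_flow.
have H : derivable phi (flow d s xi) (hfield d xi) by exact: diff_derivable.
suff E : (fun h : R => h^-1 *: (((fun s => phi (flow d s xi)) \o shift s) (h *: 1) -
     phi (flow d s xi))) =
   (fun h => h^-1 *: ((phi \o shift (flow d s xi)) (h *: hfield d xi) - phi (flow d s
     xi))).
  by apply: DeriveDef; rewrite /derivable /derive E.
apply/funext => h /=; rewrite /flow; congr (_ *: (phi _ - _)).
by rewrite [h *: 1]mulr1 scalerDl addrCA.
Qed.

Let flow_lin d (s : R) (v : V) : V := v + (s * hcoef d v) *: dT R N.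

Lemma flow_affine d s (h : R) (v y : V) :
  flow d s (h *: v + y) = h *: flow_lin d s v + flow d s y.
Proof.
rewrite /flow /flow_lin /hfield.
have -> : hcoef d (h *: v + y) = h * hcoef d v + hcoef d y.
  by rewrite /hcoef; case: d => -[] i /=; rewrite !mxE; ring.
rewrite !scalerDr !scalerA mulrDr scalerDl (mulrCA s h) -!addrA; congr (_ + _).
by rewrite [RHS]addrCA; congr (_ + _); rewrite [RHS]addrCA.
Qed.

Lemma differentiable_flow d s xi : differentiable (flow d s) xi.
Proof.
apply: differentiableD => //; apply: differentiableZ.
apply: differentiableD => //; apply: differentiableZl.
exact: smooth_differentiable (smooth_hcoef 0 d) xi.
Qed.

Lemma smooth_flow k d s phi : smooth k phi -> smooth k (fun xi => phi (flow d s xi)).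
Proof.
apply: (@smooth_affine_comp _ _ _ _ (flow_lin d s)).
- exact: differentiable_flow.
- by have [] := preserves_flow d s.
- exact: flow_affine.
Qed.

(** A field is invariant under its own flow. *)
Lemma hder_flow d s phi xi : (forall x, differentiable phi x) ->
  hder d (fun xi => phi (flow d s xi)) xi = hder d phi (flow d s xi).
Proof.
move=> dphi; have dc : differentiable (fun xi => phi (flow d s xi)) xi.
  apply: (differentiable_comp (g := phi)); first exact: differentiable_flow.
  exact: dphi.
rewrite (hderE d dc) (hderE d (dphi _)).
rewrite (@derive_affine_comp _ _ (flow d s) (flow_lin d s) phi); last exact: flow_affine.
rewrite hfield_flow; congr (derive _ _ _).
rewrite /flow_lin (_ : hcoef d _ = 0) ?mulr0 ?scale0r ?addr0//.
by rewrite /hfield /hdir /hcoef /dT; case: d {dc} => -[] i;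
  rewrite /= !mxE ?mulr0 ?addr0 ?mulr0 ?oppr0.
Qed.

End horizontal_flows.

(** * Compactly supported test functions *)

Section closed_balls.
Variables (R : realType) (N : nat).
Local Notation V := (heis R N).
Local Notation mu := (@heis_measure R N).
Implicit Types (xi : V) (phi : V -> R).

Definition heis_cball (xi0 : V) (r : R) : set V :=
  [set eta | heis_norm (heis_mul (heis_inv eta) xi0) <= r].

Lemma heis_cball_mulr (xi0 xi zeta : V) (r s : R) :
  heis_cball xi0 r xi -> heis_norm zeta <= s ->
  heis_cball xi0 (r + s) (heis_mul xi zeta).
Proof.
rewrite /heis_cball /= => xir zs; rewrite heis_invM -heis_mulA.
by apply: le_trans (heis_normM _ _) _; rewrite heis_normV addrC lerD.
Qed.

Lemma subset_cball_ball (xi0 : V) (r s : R) : r < s ->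
  heis_cball xi0 r `<=` heis_ball xi0 s.
Proof. by move=> rs eta /le_lt_trans; exact. Qed.

Lemma smooth_dotv_const k (a : 'rV[R]_N) :
  smooth k (fun z : V => dotv z.1.1 a) /\ smooth k (fun z : V => dotv z.1.2 a).
Proof.
by split; apply: smooth_sum => i; apply: smoothM;
  solve [exact: smooth_cst|exact: smooth_x|exact: smooth_y].
Qed.

Lemma smooth_gauge k : smooth k (@heis_gauge R N).
Proof.
apply: smoothD; last by apply: smoothX; exact: smooth_t.
by apply: smoothX; apply: smoothD; apply: smooth_sum => i; apply: smoothM;
  solve [exact: smooth_x|exact: smooth_y].
Qed.

(** A polynomial in eta, hence smooth, whose sublevel sets are the balls
    centered at xi0. *)
Definition gauge_from (xi0 eta : V) : R := heis_gauge (heis_mul (heis_inv eta) xi0).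

Lemma smooth_gauge_from k xi0 : smooth k (gauge_from xi0).
Proof.
apply: smoothD; apply: smoothX.
  apply: smoothD; apply: smooth_sum => i; apply: smoothM.
  1,2: apply: (@eq_smooth _ _ _ (fun z => xi0.1.1 ord0 i - z.1.1 ord0 i));
    [by move=> z; rewrite /heis_mul /heis_inv /= !mxE addrC|
     by apply: smoothB; [exact: smooth_cst|exact: smooth_x]].
  1,2: apply: (@eq_smooth _ _ _ (fun z => xi0.1.2 ord0 i - z.1.2 ord0 i));
    [by move=> z; rewrite /heis_mul /heis_inv /= !mxE addrC|
     by apply: smoothB; [exact: smooth_cst|exact: smooth_y]].
apply: (@eq_smooth _ _ _ (fun z => xi0.2 - z.2 +
    2 * (dotv z.1.1 xi0.1.2 - dotv z.1.2 xi0.1.1))).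
  move=> z; rewrite /heis_mul /heis_inv /= !dotvE (dotvC xi0.1.1); ring.
apply: smoothD; first by apply: smoothB; [exact: smooth_cst|exact: smooth_t].
apply: smoothM; first exact: smooth_cst.
by apply: smoothB; [exact: (smooth_dotv_const k _).1|exact: (smooth_dotv_const k _).2].
Qed.

(** A closed ball is a left translate of one centered at the origin, which is
    closed and contained in a box. *)
Lemma compact_heis_cball (xi0 : V) (r : R) : compact (heis_cball xi0 r).
Proof.
have [r0|r0] := ltP r 0.
  rewrite (_ : heis_cball _ _ = set0); first exact: compact0.
  rewrite -subset0 => z /=; apply/negP; rewrite -ltNge.
  by apply: lt_le_trans r0 _; exact: heis_norm_ge0.
pose I : set 'rV[R]_N := [set v | forall i, `[- r, r]%classic (v ord0 i)].
pose box : set V := (I `*` I) `*` `[- (r ^+ 2), r ^+ 2]%classic.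
have cbox : compact box.
  have cI : compact I by apply: (@rV_compact _ _ (fun=> `[- r, r]%classic)) => i;
    exact: segment_compact.
  by apply: compact_setX; [exact: compact_setX|exact: segment_compact].
pose K : set V := [set z | heis_norm z <= r].
have KE : K = @heis_gauge R N @^-1` [set y | y <= r ^+ 4].
  by apply/seteqP; split => z; rewrite /K /= heis_norm_le.
have abs1 (a b : R) : 0 <= b -> a ^+ 2 <= b ^+ 2 -> - b <= a <= b.
  by move=> b0 ab; rewrite -ler_norml -(ler_pXn2r (_ : 0 < 2)%N) ?nnegrE//
    real_normK ?num_real.
have cK : compact K.
  apply: (@subclosed_compact _ K box) => //.
    rewrite KE; apply: preimage_closed; last exact: closed_le.
    by move=> z _; exact: (smooth_continuous (smooth_gauge 0)).
  move=> -[[x y] t]; rewrite KE /= /heis_gauge /= => g1.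
  have x0 := dotvv_ge0 x; have y0 := dotvv_ge0 y.
  have z1 : dotv x x + dotv y y <= r ^+ 2.
    have zz : (dotv x x + dotv y y) ^+ 2 <= (r ^+ 2) ^+ 2.
      by rewrite -exprM; apply: le_trans g1; rewrite lerDl sqr_ge0.
    by have /andP[] := abs1 _ _ (sqr_ge0 r) zz.
  split; [split|] => /= [i|i|]; rewrite ?in_itv; apply: abs1; rewrite ?sqr_ge0//.
  + apply: le_trans (sqr_coord_le_dotvv _ _) _.
    by apply: le_trans z1; rewrite lerDl.
  + apply: le_trans (sqr_coord_le_dotvv _ _) _.
    by apply: le_trans z1; rewrite lerDr.
  + by rewrite -exprM; apply: le_trans g1; rewrite lerDr sqr_ge0.
rewrite (_ : heis_cball xi0 r = heis_mul xi0 @` K).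
  apply: continuous_compact cK; apply: continuous_subspaceT => z.
  have c1 : continuous (fun z : V => z.1) by move=> y; exact: cvg_fst.
  have c11 : continuous (fun z : V => z.1.1).
    by move=> y; apply: (cvg_comp _ _ (c1 y)); exact: cvg_fst.
  have c12 : continuous (fun z : V => z.1.2).
    by move=> y; apply: (cvg_comp _ _ (c1 y)); exact: cvg_snd.
  have H1 : xi0.1.1 + y.1.1 @[y --> z] --> xi0.1.1 + z.1.1.
    by apply: cvgD; [exact: cvg_cst|exact: c11].
  have H2 : xi0.1.2 + y.1.2 @[y --> z] --> xi0.1.2 + z.1.2.
    by apply: cvgD; [exact: cvg_cst|exact: c12].
  pose f (y : V) := xi0.2 + y.2 + 2 * (dotv y.1.1 xi0.1.2 - dotv xi0.1.1 y.1.2).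
  have sf : smooth 0 f.
    apply: (@eq_smooth _ _ _ (fun y : V =>
      xi0.2 + y.2 + 2 * (dotv y.1.1 xi0.1.2 - dotv y.1.2 xi0.1.1))).
      by move=> y; rewrite /f (dotvC xi0.1.1).
    apply: smoothD; first by apply: smoothD; [exact: smooth_cst|exact: smooth_t].
    apply: smoothM; first exact: smooth_cst.
    by apply: smoothB; [exact: (smooth_dotv_const _ _).1|exact: (smooth_dotv_const _
      _).2].
  have H3 : f y @[y --> z] --> f z by exact: smooth_continuous sf z.
  have H12 : (xi0.1.1 + y.1.1, xi0.1.2 + y.1.2) @[y --> z] -->
      (xi0.1.1 + z.1.1, xi0.1.2 + z.1.2) by exact: cvg_pair H1 H2.
  exact: cvg_pair H12 H3.
apply/seteqP; split => [eta etar|_ [z zr <-]].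
  exists (heis_mul (heis_inv xi0) eta); last exact: heis_mulKV.
  by rewrite /K /= -heis_normV heis_invM heis_invK.
by rewrite /heis_cball /= heis_invM -heis_mulA heis_mulVg heis_mulg0 heis_normV.
Qed.

Lemma test_function_cball (xi0 : V) (r rho : R) phi : r < rho ->
  (forall k, smooth k phi) -> (forall xi, ~ heis_cball xi0 r xi -> phi xi = 0) ->
  test_function (heis_ball xi0 rho) phi.
Proof.
move=> rrho sphi phi0; split; first by move=> k; exact: smooth_Ck.
exists (heis_cball xi0 r); split=> //; first exact: compact_heis_cball.
exact: subset_cball_ball.
Qed.

End closed_balls.

(** * Translation along a horizontal field *)

Lemma lipschitz_of_derive (R : realType) (f : R -> R) (a M t : R) :
  (forall s, `|s| < a -> derivable f s 1) ->
  (forall s, `|s| < a -> `|f^`()%classic s| <= M) ->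
  `|t| < a -> `|f t - f 0| <= M * `|t|.
Proof.
move=> df fM ta.
have sub b c x : `|b| < a -> `|c| < a -> x \in `[b, c] -> `|x| < a.
  by rewrite in_itv /= !ltr_norml => /andP[? ?] /andP[? ?] /andP[? ?]; apply/andP;
    split; lra.
have mv b c : `|b| < a -> `|c| < a -> b <= c -> `|f c - f b| <= M * (c - b).
  move=> ba ca bc.
  have [||x xbc ->] := @MVT_segment R f f^`()%classic b c bc.
  - move=> x xbc; apply: DeriveDef; last by rewrite derive1E.
    by apply/df/(sub b c) => //; exact: subset_itv_oo_cc.
  - by apply: derivable_within_continuous => x xbc; exact/df/(sub b c).
  - by rewrite normrM [`|c - b|]ger0_norm ?subr_ge0// ler_wpM2r ?subr_ge0// fM//
    (sub b c).
have a0 : `|0 : R| < a by rewrite normr0; apply: le_lt_trans ta.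
have [t0|t0] := leP 0 t.
  by rewrite (le_trans (mv 0 t a0 ta t0))// subr0 (ger0_norm t0).
rewrite distrC; apply: le_trans (mv t 0 ta a0 (ltW t0)) _.
by rewrite sub0r (ltr0_norm t0).
Qed.

Section translation_estimate.
Variables (R : realType) (N : nat).
Local Notation V := (heis R N).
Local Notation mu := (@heis_measure R N).

Definition hgrad_coord (d : bool * 'I_N) (g : V -> 'rV[R]_N * 'rV[R]_N) (x : V) : R :=
  if d.1 then (g x).1 ord0 d.2 else (g x).2 ord0 d.2.

(** Off the compact set the derivative vanishes, on it continuity gives a bound. *)
Lemma hder_bounded (xi0 : V) (r : R) (d : bool * 'I_N) (phi : V -> R) :
  (forall k, smooth k phi) -> (forall xi, ~ heis_cball xi0 r xi -> phi xi = 0) ->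
  exists2 C : R, 0 <= C & forall xi, `|hder d phi xi| <= C.
Proof.
move=> sphi phi0; have cK := @compact_heis_cball R N xi0 r.
have hc : continuous (hder d phi) by exact: smooth_continuous (smooth_hder d (sphi 1%N)).
have /compact_bounded[M [_ HM]] : compact (hder d phi @` heis_cball xi0 r).
  by apply: continuous_compact => //; exact: continuous_subspaceT.
exists (`|M| + 1) => [|xi]; first by rewrite addr_ge0.
have [Kxi|nKxi] := pselect (heis_cball xi0 r xi).
  apply: (HM (`|M| + 1)); last by exists xi.
  by rewrite ltr_pwDr// ler_norm.
rewrite hderE; last exact: smooth_differentiable (sphi 0%N) xi.
rewrite (@near_eq_derive _ _ _ _ (fun=> 0)) ?derive_cst ?normr0 ?addr_ge0//.
have oK : open (~` heis_cball xi0 r).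
  rewrite openC; apply: compact_closed cK; exact: norm_hausdorff.
by near=> y; apply: phi0; near: y; exact: open_nbhs_nbhs.
Unshelve. all: end_near. Qed.

Variables (xi0 : V) (rho : R).
Local Notation U := (heis_ball xi0 rho).
Variables (u : V -> R) (g : V -> 'rV[R]_N * 'rV[R]_N) (d : bool * 'I_N) (G : R).
Hypothesis iu : mu.-integrable setT (EFin \o (u \_ U)).
Hypothesis wg : weak_hgrad U u g.
Hypothesis mg : measurable_fun U (hgrad_coord d g).
Hypothesis gG : (\int[mu]_(x in U) `|hgrad_coord d g x|%:E <= G%:E)%E.

Let mU : measurable U := @measurable_heis_ball R N xi0 rho.

Section one_test_function.
Variables (r : R) (phi : V -> R).
Hypothesis sphi : forall k, smooth k phi.
Hypothesis phi1 : forall x, `|phi x| <= 1.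
Hypothesis phi0 : forall xi, ~ heis_cball xi0 r xi -> phi xi = 0.

Let pairing (s : R) : R := \int[mu]_x ((u \_ U) x * phi (flow d s x)).

Let dphi x : differentiable phi x := smooth_differentiable (sphi 0%N) x.

Let mflow s : measurable_fun setT (fun x => phi (flow d s x)).
Proof. exact: smooth_measurable (smooth_flow d s (sphi 0%N)). Qed.

Let integrable_mul (h : V -> R) (C : R) : measurable_fun setT h ->
  (forall x, `|h x| <= C) -> mu.-integrable setT (EFin \o (fun x => (u \_ U) x * h x)).
Proof.
move=> mh hC; have := integrableMl measurableT iu mh.
apply; exists C; split; first exact: num_real.
by move=> M CM x _; apply: le_trans (hC x) (ltW CM).
Qed.

(** The defining property of the weak gradient for the test function
   phi o flow s, whose support is still in the ball. *)
Let weak_flow s : r + `|s| < rho ->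
  (\int[mu]_x ((u \_ U) x * hder d phi (flow d s x))%:E =
   - \int[mu]_(x in U) (hgrad_coord d g x * phi (flow d s x))%:E)%E.
Proof.
move=> rs; have [] : test_function U (fun x => phi (flow d s x)).
  apply: (test_function_cball rs) => [k|x nx]; first exact: smooth_flow.
  apply: phi0 => Kx; apply: nx; rewrite -(flowK d s x) flowE.
  by apply: heis_cball_mulr => //; rewrite heis_norm_hdir normrN.
move=> t1 t2; have /wg/(_ d.2)[wX wY] := conj t1 t2.
transitivity (\int[mu]_(x in U) (u x * hder d (fun x => phi (flow d s x)) x)%:E)%E.
  rewrite [RHS]integral_mkcond; apply: eq_integral => x _.
  rewrite !patchE; case: ifP => _; last by rewrite mul0r.
  by rewrite hder_flow.
by move: wX wY; rewrite /hder /hgrad_coord; case: d => -[] i.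
Qed.

Let pairing_le s : r + `|s| < rho ->
  `|\int[mu]_x ((u \_ U) x * hder d phi (flow d s x))| <= G.
Proof.
move=> rs; rewrite /Rintegral weak_flow// fineN normrN.
have mgp : measurable_fun U (fun x => hgrad_coord d g x * phi (flow d s x)).
  by apply: measurable_funM => //; exact: measurable_funTS.
have H : (`|\int[mu]_(x in U) (hgrad_coord d g x * phi (flow d s x))%:E| <= G%:E)%E.
  apply: le_trans gG; apply: le_trans (le_abse_integral mu mU _) _.
    exact/measurable_EFinP.
  apply: ge0_le_integral => //.
  - by apply/measurable_EFinP; exact: measurableT_comp.
  - by apply/measurable_EFinP; exact: measurableT_comp.
  - by move=> x _; rewrite lee_fin normrM ler_piMr.
by move: H; case: (integral _ _ _).
Qed.

Let derive_pairing s : r + `|s| < rho ->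
  derivable pairing s 1 /\
  pairing^`()%classic s = \int[mu]_x ((u \_ U) x * hder d phi (flow d s x)).
Proof.
move=> rs; have [C C0 HC] := hder_bounded d sphi phi0.
have E1 (x : V) (t : R) : is_derive t 1 (fun t : R => (u \_ U) x * phi (flow d t x))
    ((u \_ U) x * hder d phi (flow d t x)).
  by have H := is_derive_flow d x t dphi; exact: (is_deriveZ ((u \_ U) x) H).
have E2 (t : R) (x : V) : partial1of2 (fun (t : R) (x : V) =>
  (u \_ U) x * phi (flow d t x)) t x =
    (u \_ U) x * hder d phi (flow d t x).
  by rewrite /partial1of2 derive1E; have [_ ->] := E1 x t.
have Ia : `]s - 1, s + 1[%classic s by rewrite /= in_itv /=; apply/andP; split; lra.
have intf (t : R) : `]s - 1, s + 1[%classic t ->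
    mu.-integrable setT (EFin \o (fun x => (u \_ U) x * phi (flow d t x))).
  by move=> _; exact: integrable_mul.
have df (t : R) (x : V) : `]s - 1, s + 1[%classic t -> setT x ->
    derivable ((fun (t : R) (x : V) => (u \_ U) x * phi (flow d t x)) ^~ x) t 1.
  by move=> _ _; case: (E1 x t).
have Gge0 (x : V) : 0 <= `|(u \_ U) x| * C by rewrite mulr_ge0.
have iG : mu.-integrable setT (EFin \o (fun x => `|(u \_ U) x| * C)).
  have := integrableZr measurableT C (integrable_abse iu).
  by [].
have Gub (t : R) (x : V) : `]s - 1, s + 1[%classic t -> setT x ->
    `|partial1of2 (fun (t : R) (x : V) =>
      (u \_ U) x * phi (flow d t x)) t x| <= `|(u \_ U) x| * C.
  by move=> _ _; rewrite E2 normrM ler_wpM2l.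
split; first exact: (derivable_under_integral measurableT Ia intf df Gge0 iG Gub).
rewrite (differentiation_under_integral measurableT Ia intf df Gge0 iG Gub).
by apply: eq_Rintegral => x _; exact: E2.
Qed.

(** Moving the translation from u to phi turns the left-hand side into
    pairing (- t) - pairing 0, and the derivative of the pairing is bounded by the
    L^1 norm of the weak derivative of u. *)
Lemma translation_test_le t : r + `|t| < rho ->
  (\int[mu]_x (((u \_ U) (flow d t x) - (u \_ U) x) * phi x)%:E <= (G * `|t|)%:E)%E.
Proof.
move=> rt; have iphi s := integrable_mul (mflow s) (fun x => phi1 _).
have H : `|pairing (- t) - pairing 0| <= G * `|t|.
  rewrite -[`|t|]normrN; apply: (@lipschitz_of_derive _ _ (rho - r)) => [s sr|s sr|].
  - by apply: (derive_pairing _).1; rewrite -ltrBrDl.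
  - by rewrite (derive_pairing _).2 ?pairing_le// -ltrBrDl.
  - by rewrite normrN ltrBrDl.
have -> : (\int[mu]_x (((u \_ U) (flow d t x) - (u \_ U) x) * phi x)%:E =
    \int[mu]_x ((u \_ U) x * phi (flow d (- t) x))%:E -
    \int[mu]_x ((u \_ U) x * phi (flow d 0 x))%:E)%E.
  rewrite -(preserves_integral (preserves_flow d t) (iphi (- t))).
  rewrite -integralB//; last 2 first.
  - exact: preserves_integrable (preserves_flow d t) (iphi (- t)).
  - exact: iphi.
  by apply: eq_integral => x _; rewrite flowK flow0 -EFinB; congr EFin; ring.
have fin s : (\int[mu]_x ((u \_ U) x * phi (flow d s x))%:E)%E \is a fin_num.
  exact: integrable_fin_num (iphi s).
rewrite -(fineK (fin (- t))) -(fineK (fin 0)) -EFinB lee_fin.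
by apply: le_trans H; exact: ler_norm.
Qed.

End one_test_function.

End translation_estimate.

Section horizontal_translation.
Variables (R : realType) (N : nat).
Local Notation V := (heis R N).
Local Notation mu := (@heis_measure R N).
Variables (xi0 : V) (rho : R).
Local Notation U := (heis_ball xi0 rho).
Variables (u : V -> R) (g : V -> 'rV[R]_N * 'rV[R]_N) (d : bool * 'I_N) (G : R).
Hypothesis iu : mu.-integrable setT (EFin \o (u \_ U)).
Hypothesis wg : weak_hgrad U u g.
Hypothesis mg : measurable_fun U (hgrad_coord d g).
Hypothesis gG : (\int[mu]_(x in U) `|hgrad_coord d g x|%:E <= G%:E)%E.

Lemma heis_ball_empty (r : R) : r <= 0 -> heis_ball xi0 r = set0.
Proof.
move=> r0; rewrite -subset0 => z /=; apply/negP; rewrite -leNgt.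
by apply: le_trans r0 _; exact: heis_norm_ge0.
Qed.

Let chi (r : R) : nat -> V -> R := plateau (fun x => r ^+ 4 - gauge_from xi0 x).

Let chi_smooth r n : unit_smooth (chi r n).
Proof.
apply: unit_smooth_plateau => k.
by apply: smoothB; [exact: smooth_cst|exact: smooth_gauge_from].
Qed.

Let heis_ball_gauge r x : 0 < r -> (heis_ball xi0 r x : Prop) = (0 < r ^+ 4 -
  gauge_from xi0 x).
Proof. by move=> r0; rewrite /heis_ball /= heis_norm_lt// subr_gt0. Qed.

Let chi_out r n x : 0 < r -> ~ heis_ball xi0 r x -> chi r n x = 0.
Proof.
move=> r0; rewrite heis_ball_gauge// => /negP; rewrite -leNgt.
exact: plateau_out.
Qed.

Let chi_cvg r x : 0 < r ->
  chi r n x @[n --> \oo] --> (\1_(heis_ball xi0 r) x : R).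
Proof.
move=> r0; rewrite (_ : heis_ball xi0 r = [set x | 0 < r ^+ 4 - gauge_from xi0 x]).
  exact: cvg_plateau.
by apply/funext => y; exact: heis_ball_gauge.
Qed.

Let diff t x : R := (u \_ U) (flow d t x) - (u \_ U) x.

Let integrable_diff t : mu.-integrable setT (EFin \o diff t).
Proof.
have i1 := preserves_integrable (preserves_flow d t) iu.
by have := integrableB measurableT i1 iu; under eq_fun do rewrite -EFinB.
Qed.

(** Test with products of a cutoff function of the ball and an arbitrary smooth
    function, then let the cutoff increase to the indicator function. *)
Lemma horizontal_translation_le (r t : R) : r + `|t| < rho ->
  (\int[mu]_(x in heis_ball xi0 r) `|(u \_ U) (flow d t x) - (u \_ U) x|%:E
    <= (G * `|t|)%:E)%E.
Proof.
move=> rt; have [r0|r0] := leP r 0.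
  rewrite heis_ball_empty// integral_set0 lee_fin mulr_ge0//.
  by rewrite -lee_fin; apply: le_trans gG; exact: integral_ge0.
have mD : measurable_fun setT (diff t).
  by apply/measurable_EFinP; exact: measurable_int (integrable_diff t).
have mchi n : measurable_fun setT (chi r n) by exact: smooth_measurable ((chi_smooth r
  n).1 0%N).
have bound n : (\int[mu]_x `|diff t x * chi r n x|%:E <= (G * `|t|)%:E)%E.
  apply: integral_abs_le_smooth.
    apply: le_integrable (integrable_diff t) => //.
      by apply/measurable_EFinP; exact: measurable_funM.
    move=> x _; rewrite !abse_EFin lee_fin normrM ler_piMr//.
    by have /andP[? ?] := (chi_smooth r n).2 x; rewrite ger0_norm.
  move=> phi sphi phi1.
  have := @translation_test_le _ _ xi0 rho u g d G iu wg mg gG r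
    (fun x => chi r n x * phi x) _ _ _ t rt.
  under [in X in _ -> X]eq_integral do rewrite -mulrA.
  apply.
  - by move=> k; apply: smoothM => //; exact: (chi_smooth r n).1.
  - move=> x; have /andP[? ?] := (chi_smooth r n).2 x.
    by rewrite normrM -[X in _ <= X]mulr1 ler_pM// ger0_norm.
  - move=> x nx; rewrite chi_out ?mul0r// => xr; apply: nx.
    by rewrite /heis_cball /= ltW.
have mB := @measurable_heis_ball R N xi0 r.
have [|||||_ _ H] := @dominated_convergence _ _ _ mu setT measurableT
  (fun n (x : V) => `|diff t x * chi r n x|%:E)
  (fun x => `|diff t x * \1_(heis_ball xi0 r) x|%:E) (fun x : V => `|diff t x|%:E).
- by move=> n; apply/measurable_EFinP/measurableT_comp => //; exact: measurable_funM.
- by apply/measurable_EFinP/measurableT_comp => //; apply: measurable_funM => //.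
- apply: aeW => x _; apply: cvg_EFin; first exact: nearW.
  by apply: cvg_norm; apply: cvgM; [exact: cvg_cst|exact: chi_cvg].
- exact: integrable_abse (integrable_diff t).
- apply: aeW => x n _; rewrite abse_EFin normr_id lee_fin normrM ler_piMr//.
  by have /andP[? ?] := (chi_smooth r n).2 x; rewrite ger0_norm.
rewrite (_ : (\int[mu]_(x in heis_ball xi0 r) _)%E =
    (\int[mu]_x `|diff t x * \1_(heis_ball xi0 r) x|%:E)%E).
  rewrite -(cvg_lim _ H)//; apply: lime_le; first by apply/cvg_ex; eexists; exact: H.
  by apply: nearW => n; exact: bound.
rewrite integral_mkcond; apply: eq_integral => x _; rewrite patchE indicE.
by case: ifP => _ /=; rewrite ?mulr1 ?mulr0 ?normr0.
Qed.

End horizontal_translation.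

(** * Translation by an arbitrary element *)

Section translation_by_group_elements.
Variables (R : realType) (N : nat).
Local Notation V := (heis R N).
Local Notation mu := (@heis_measure R N).
Variables (xi0 : V) (rho : R).
Local Notation U := (heis_ball xi0 rho).
Variables (u : V -> R) (g : V -> 'rV[R]_N * 'rV[R]_N) (G : R).
Hypothesis iu : mu.-integrable setT (EFin \o (u \_ U)).
Hypothesis wg : weak_hgrad U u g.
Hypothesis mg : forall d, measurable_fun U (hgrad_coord d g).
Hypothesis gG : forall d, (\int[mu]_(x in U) `|hgrad_coord d g x|%:E <= G%:E)%E.
Hypothesis G0 : 0 <= G.
Variable h : R.
Hypothesis h0 : 0 <= h.

Let w : V -> R := u \_ U.

Let mw : measurable_fun setT w.
Proof. by apply/measurable_EFinP; exact: measurable_int iu. Qed.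

Let mdiff (zeta : V) : measurable_fun setT (fun x => `|w (heis_mul x zeta) - w x|%:E).
Proof.
apply/measurable_EFinP/measurableT_comp => //; apply: measurable_funB => //.
by apply: (measurableT_comp mw); apply: measurable_heis_mul.
Qed.

(** What n successive horizontal translations of length at most h guarantee.
    The condition on r keeps the whole path from the ball of radius r inside the
    domain of u. *)
Definition reachable (n : nat) (zeta : V) :=
  heis_norm zeta <= n%:R * h /\ forall r, r + n%:R * h < rho ->
  (\int[mu]_(x in heis_ball xi0 r) `|w (heis_mul x zeta) - w x|%:E
     <= (n%:R * h * G)%:E)%E.

Lemma reachable_hdir d (t : R) : `|t| <= h -> reachable 1 (t *: hdir R d).
Proof.
move=> th; rewrite /reachable mul1r heis_norm_hdir; split=> // r rh.
under eq_integral do rewrite -flowE.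
apply: le_trans (horizontal_translation_le iu wg (mg d) (gG d) _) _.
  by apply: le_lt_trans rh; rewrite lerD2l.
by rewrite lee_fin mulrC ler_wpM2r.
Qed.

Lemma reachable0 : reachable 0 0.
Proof.
rewrite /reachable !mul0r; split=> [|r _].
  by rewrite heis_norm_le// /heis_gauge /= !dotvE !addr0 !expr0n /= addr0.
rewrite (eq_integral (fun=> 0%E)) ?integral0// => x _.
by rewrite heis_mulg0 subrr normr0.
Qed.

(** u (x z1 z2) - u x splits into the increment by z1 at x and the increment by z2 at
    x z1. For the second one the measure is invariant under right translation by
    z1, which moves the ball of radius r into one of radius r + m h. *)
Lemma reachableM m n zeta1 zeta2 : reachable m zeta1 -> reachable n zeta2 ->
  reachable (m + n) (heis_mul zeta1 zeta2).
Proof.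
move=> [z1 E1] [z2 E2]; split.
  by rewrite natrD mulrDl; apply: le_trans (heis_normM _ _) _; exact: lerD.
move=> r; rewrite natrD !mulrDl => rmn.
have mB := @measurable_heis_ball R N xi0 r.
pose k y : \bar R := `|w (heis_mul y zeta2) - w y|%:E.
have k0 y : (0 <= k y)%E by rewrite /k lee_fin.
have mk : measurable_fun setT k by exact: mdiff.
have mkc : measurable_fun setT (fun x => k (heis_mul x zeta1)).
  by apply: (measurableT_comp mk); exact: measurable_heis_mul.
apply: (@le_trans _ _ (\int[mu]_(x in heis_ball xi0 r)
   (`|w (heis_mul x zeta1) - w x|%:E + k (heis_mul x zeta1)))%E).
  apply: ge0_le_integral => //.
  - exact: measurable_funTS.
  - by apply: emeasurable_funD; exact: measurable_funTS.
  - move=> x _; rewrite /k -EFinD lee_fin heis_mulA [leRHS]addrC.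
    have := ler_normD (w (heis_mul (heis_mul x zeta1) zeta2) - w (heis_mul x zeta1))
      (w (heis_mul x zeta1) - w x).
    by rewrite subrKA.
rewrite ge0_integralD//; try exact: measurable_funTS.
rewrite EFinD; apply: leeD.
  apply: E1; apply: le_lt_trans rmn; rewrite lerD2l lerDl mulr_ge0//.
pose B' := heis_ball xi0 (r + m%:R * h).
have mB' : measurable B' by exact: measurable_heis_ball.
have mkB' : measurable_fun setT (k \_ B').
  by apply/(measurable_restrictT _ mB'); exact: measurable_funTS.
apply: (@le_trans _ _ (\int[mu]_x (k \_ B') (heis_mul x zeta1))%E).
  rewrite integral_mkcond; apply: ge0_le_integral => //.
  - by move=> x _; rewrite patchE; case: ifP.
  - by apply/(measurable_restrictT _ mB); exact: measurable_funTS.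
  - by apply: (measurableT_comp mkB'); exact: measurable_heis_mul.
  - move=> x _; rewrite !patchE; case: ifPn => [|_]; last by case: ifP.
    by rewrite inE => xr; rewrite mem_set//; exact: heis_ball_mulr.
rewrite (preserves_ge0_integral (preserves_measure_mulr zeta1)); last 2 first.
- exact: mkB'.
- by move=> x; rewrite patchE; case: ifP.
by rewrite -integral_mkcond; apply: E2; rewrite -addrA.
Qed.

Lemma reachable_horizontal (b : bool) (v : 'rV[R]_N) :
  (forall i, `|v ord0 i| <= h) ->
  reachable N (if b then (v, 0, 0) else (0, v, 0)).
Proof.
move=> vh.
have H (s : seq 'I_N) : let v' := \sum_(i <- s) v ord0 i *: delta_mx ord0 i in
    reachable (size s) (if b then (v', 0, 0) else (0, v', 0)).
  elim: s => [|i s IHs] /=.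
    by rewrite big_nil; case: b; exact: reachable0.
  have := reachableM (reachable_hdir (b, i) (vh i)) IHs.
  rewrite add1n big_cons; congr reachable.
  case: b {IHs}; rewrite /heis_mul /hdir /=; congr (_, _, _);
    rewrite /= ?scaler0 ?dotvE ?addr0 ?add0r//; ring.
have := H (index_enum 'I_N); rewrite /= -row_sum_delta.
by rewrite [index_enum _]/index_enum -enumT size_enum_ord.
Qed.

(** The commutator of exp (p X) and exp (q Y) is (0, 0, - 4 p q). *)
Lemma reachable_vertical (i : 'I_N) (t : R) : `|t| <= 4 * h ^+ 2 ->
  reachable 4 (0, 0, t).
Proof.
move=> th; pose p := Num.sqrt `|t| / 2.
have p0 : 0 <= p by rewrite divr_ge0// sqrtr_ge0.
have pE : 4 * p ^+ 2 = `|t|.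
  by rewrite /p expr_div_n sqr_sqrtr//; field.
have ph : `|p| <= h.
  rewrite ger0_norm// -(ler_pXn2r (_ : 0 < 2)%N) ?nnegrE//.
  by move: pE th; lra.
have comm q : `|q| <= h -> reachable 4 (0, 0, - (4 * p * q)).
  move=> qh; have nph : `|- p| <= h by rewrite normrN.
  have nqh : `|- q| <= h by rewrite normrN.
  have := reachableM
    (reachableM (reachable_hdir (true, i) ph) (reachable_hdir (false, i) qh))
    (reachableM (reachable_hdir (true, i) nph) (reachable_hdir (false, i) nqh)).
  congr reachable; rewrite /heis_mul /hdir /=; congr (_, _, _);
  rewrite /= ?scaler0 ?addr0 ?add0r -?scalerDl ?subrr ?scale0r//.
  rewrite !dotvE !dotv_delta_l !mxE !eqxx /=; ring.
have [t0|t0] := leP 0 t.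
  have nph : `|- p| <= h by rewrite normrN.
  have := comm _ nph; congr (reachable _ (_, _, _)).
  by rewrite -[RHS](ger0_norm t0) -pE; ring.
have := comm _ ph; congr (reachable _ (_, _, _)).
by rewrite -[RHS]opprK -(ltr0_norm t0) -pE; ring.
Qed.

(** The horizontal fields generate the group: a point of norm at most h is
    reached by N moves along the X fields, N moves along the Y fields and a
    commutator of four moves. *)
Lemma reachable_ball (i : 'I_N) (zeta : V) : heis_norm zeta <= h ->
  reachable (N + N + 4) zeta.
Proof.
rewrite heis_norm_le//; case: zeta => -[x y] t; rewrite /heis_gauge /= => zh.
have x0 := dotvv_ge0 x; have y0 := dotvv_ge0 y.
have absle (a b : R) : 0 <= b -> a ^+ 2 <= b ^+ 2 -> `|a| <= b.
  by move=> b0 ab; rewrite -(ler_pXn2r (_ : 0 < 2)%N) ?nnegrE// real_normK ?num_real.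
have z1 : dotv x x + dotv y y <= h ^+ 2.
  have : `|dotv x x + dotv y y| <= h ^+ 2.
    apply: absle; first exact: sqr_ge0.
    by rewrite -exprM; apply: le_trans zh; rewrite lerDl sqr_ge0.
  by rewrite ger0_norm// addr_ge0.
have t1 : `|t| <= h ^+ 2.
  apply: absle; first exact: sqr_ge0.
  by rewrite -exprM; apply: le_trans zh; rewrite lerDr sqr_ge0.
have xh j : `|x ord0 j| <= h.
  apply: absle => //; apply: le_trans (sqr_coord_le_dotvv _ _) _.
  by apply: le_trans z1; rewrite lerDl.
have yh j : `|y ord0 j| <= h.
  apply: absle => //; apply: le_trans (sqr_coord_le_dotvv _ _) _.
  by apply: le_trans z1; rewrite lerDr.
have th : `|t + 2 * dotv x y| <= 4 * h ^+ 2.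
  have D1 := dotvv_ge0 (x + y); have D2 := dotvv_ge0 (x - y).
  move: D1 D2; rewrite !dotvE (dotvC y x) => D1 D2.
  by move: t1; rewrite !ler_norml => /andP[? ?]; apply/andP; split; lra.
have := reachableM (reachableM (reachable_horizontal true xh)
  (reachable_horizontal false yh)) (reachable_vertical i th).
congr reachable; rewrite /heis_mul /=; congr (_, _, _); rewrite /= ?addr0 ?add0r//.
by rewrite !dotvE; ring.
Qed.

End translation_by_group_elements.

(** * Averaging *)

Section averaging.
Variables (R : realType) (N : nat).
Local Notation V := (heis R N).
Local Notation mu := (@heis_measure R N).
Variable w : V -> R.
Hypothesis mw : measurable_fun setT w.

Let mdiff : measurable_fun setT (fun z : V * V => w (heis_mul z.1 z.2) - w z.1).
Proof.
apply: measurable_funB; last exact: measurableT_comp mw measurable_fst.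
apply: (measurableT_comp mw); apply: measurable_heis_mul.
  exact: measurable_fst.
exact: measurable_snd.
Qed.

(** Otherwise the integral over A x W of the difference would be at least M |A|,
    whereas Tonelli's theorem bounds it by C |W|. *)
Lemma exists_small_mean_oscillation (A K W : set V) (C M : R) :
  measurable A -> measurable K -> measurable W -> A `<=` K -> 0 <= M ->
  (forall zeta, W zeta ->
    (\int[mu]_(x in K) `|w (heis_mul x zeta) - w x|%:E <= C%:E)%E) ->
  (C%:E * mu W < M%:E * mu A)%E ->
  exists2 x, A x & (\int[mu]_(zeta in W) `|w (heis_mul x zeta) - w x|%:E < M%:E)%E.
Proof.
move=> mA mK mW AK M0 HC; apply: contraPP => nox; apply/negP; rewrite -leNgt.
pose f (z : V * V) : \bar R :=
  (\1_A z.1 * \1_W z.2 * `|w (heis_mul z.1 z.2) - w z.1|)%:E.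
have f0 z : (0 <= f z)%E by rewrite /f lee_fin !mulr_ge0// indicE ler0n.
have mf : measurable_fun setT f.
  apply/measurable_EFinP; apply: measurable_funM; last exact: measurableT_comp.
  apply: measurable_funM.
    exact: (measurableT_comp (measurable_indic mA) measurable_fst).
  exact: (measurableT_comp (measurable_indic mW) measurable_snd).
have mx zeta : measurable_fun setT (fun x => `|w (heis_mul x zeta) - w x|%:E).
  apply/measurable_EFinP; apply: measurableT_comp => //.
  exact: (measurableT_comp mdiff (measurable_pair2 zeta)).
have mz x : measurable_fun setT (fun zeta => `|w (heis_mul x zeta) - w x|%:E).
  apply/measurable_EFinP; apply: measurableT_comp => //.
  exact: (measurableT_comp mdiff (measurable_pair1 x)).
apply: (@le_trans _ _ (\int[mu]_x \int[mu]_zeta f (x, zeta))%E).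
  rewrite -integral_cst// integral_mkcond; apply: ge0_le_integral => //.
  - by move=> x _; rewrite patchE; case: ifP => // _; rewrite lee_fin.
  - by apply/(measurable_restrictT _ mA).
  - exact: (measurable_fun_fubini_tonelli_F f mf f0).
  - move=> x _; rewrite patchE; case: ifPn => [|_]; last exact: integral_ge0.
    rewrite inE => Ax; rewrite leNgt; apply/negP => H; apply: nox; exists x => //.
    apply: le_lt_trans H; rewrite integral_mkcond le_eqVlt; apply/orP; left; apply/eqP.
    apply: eq_integral => zeta _; rewrite /f patchE /= !indicE (mem_set Ax) mul1r.
    by case: ifP => _; rewrite ?mul1r ?mul0r.
rewrite (fubini_tonelli f mf f0) -integral_cst// [leRHS]integral_mkcond.
apply: ge0_le_integral => //.
- by move=> zeta _; exact: integral_ge0.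
- exact: (measurable_fun_fubini_tonelli_G f mf f0).
- by apply/(measurable_restrictT _ mW).
- move=> zeta _; rewrite patchE; case: ifPn => [|nW]; last first.
    rewrite (eq_integral (fun=> 0%E)) ?integral0// => x _.
    by rewrite /f /= !indicE (negbTE nW) mulr0 mul0r.
  rewrite inE => Wz; apply: le_trans (HC zeta Wz).
  rewrite [leRHS]integral_mkcond; apply: ge0_le_integral => //.
  + exact: (measurableT_comp mf (measurable_pair2 zeta)).
  + by apply/(measurable_restrictT _ mK); exact: measurable_funTS.
  + move=> x _; rewrite /f patchE /= !indicE (mem_set Wz) mulr1.
    case: ifPn => [|nK]; last by rewrite memNset ?mul0r// => /AK; move: nK;
      rewrite notin_setE.
    by move=> _; rewrite lee_fin; case: (x \in A); rewrite /= ?mul1r ?mul0r.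
Qed.

(** Chebyshev's inequality: where u is at most lambda c, it differs from u x by at
    least (1 - lambda) c. *)
Lemma superlevel_density (x : V) (W : set V) (c lambda delta m : R) :
  measurable W -> mu W = m%:E -> 0 < c -> lambda < 1 -> c < w x ->
  (\int[mu]_(zeta in W) `|w (heis_mul x zeta) - w x|%:E <
    (delta * ((1 - lambda) * c) * m)%:E)%E ->
  (((1 - delta) * m)%:E <
    mu (W `&` [set zeta | (lambda * c < w (heis_mul x zeta))%R]))%E.
Proof.
move=> mW Wm c0 l1 wx; set S := [set zeta | _] => Hint.
have mwx : measurable_fun setT (fun zeta => w (heis_mul x zeta)).
  by apply: (measurableT_comp mw); exact: measurable_heis_mul.
have mS : measurable S by exact: measurable_gt.
have mz : measurable_fun setT (fun zeta => `|w (heis_mul x zeta) - w x|%:E).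
  by apply/measurable_EFinP/measurableT_comp => //; exact: measurable_funB.
have lc : 0 < (1 - lambda) * c by rewrite mulr_gt0// subr_gt0.
have mB : measurable (W `\` S) by exact: measurableD.
have HB : (((1 - lambda) * c)%:E * mu (W `\` S) <
    (delta * ((1 - lambda) * c) * m)%:E)%E.
  apply: le_lt_trans Hint; rewrite -integral_cst//.
  apply: (@le_trans _ _ (\int[mu]_(zeta in W `\` S) `|w (heis_mul x zeta) - w x|%:E)%E).
    apply: ge0_le_integral => //; first by move=> z _; rewrite lee_fin ltW.
      exact: measurable_funTS.
    move=> z [_ /= /negP]; rewrite -leNgt lee_fin => wz.
    rewrite distrC; apply: le_trans (ler_norm _); move: wx wz; lra.
  apply: ge0_subset_integral => //; exact: measurable_funTS.
have : (m%:E = mu (W `\` S) + mu (W `&` S))%E by rewrite -Wm; exact: measureDI.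
have : (0 <= mu (W `\` S))%E by [].
have : (0 <= mu (W `&` S))%E by [].
move: HB; case: (mu (W `\` S)) => [b||]; last by [].
  case: (mu (W `&` S)) => [a||]//=.
  rewrite -EFinM -EFinD !lte_fin => H _ _ [] mE; rewrite mE in H *.
  have : b < delta * (b + a) by rewrite -(ltr_pM2l lc); move: H; lra.
  by lra.
by rewrite gt0_muley// lte_fin.
Qed.

End averaging.

(** * Bounds from the Sobolev norm, and conclusion *)

Lemma bernoulli_le (R : realType) (x : R) (n : nat) :
  0 <= x <= 1 -> 1 - n%:R * x <= (1 - x) ^+ n.
Proof.
move=> /andP[x0 x1]; elim: n => [|n IHn]; first by rewrite mul0r subr0.
rewrite exprS; have x2 : 0 <= 1 - x by rewrite subr_ge0.
apply: le_trans (ler_wpM2l x2 IHn); rewrite -[n.+1]addn1 natrD.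
have : 0 <= n%:R * x ^+ 2 by rewrite mulr_ge0// sqr_ge0.
nra.
Qed.

Section sobolev_bounds.
Variables (R : realType) (N : nat).
Local Notation V := (heis R N).
Local Notation mu := (@heis_measure R N).

Lemma L2_integrable (U : set V) (u : V -> R) : measurable U -> (mu U < +oo)%E ->
  L2 U u -> mu.-integrable setT (EFin \o (u \_ U)).
Proof.
move=> mU Uoo [mu_ iu2].
have i1 : mu.-integrable U (fun=> 1%E).
  apply/integrableP; split; first exact: measurable_cst.
  by rewrite (eq_integral (cst 1%E)) ?integral_cst ?mul1e// => x _; rewrite /= normr1.
have iu : mu.-integrable U (EFin \o u).
  apply: (@le_integrable _ _ _ _ _ mU _ (fun x => (1 + u x ^+ 2)%:E)).
  - exact/measurable_EFinP.
  - move=> x _; rewrite /= !lee_fin [leRHS]ger0_norm; last by rewrite addr_ge0 ?sqr_ge0.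
    by rewrite -(real_normK (num_real (u x))); have := sqr_ge0 (`|u x| - 2^-1); nra.
  - by under eq_fun do rewrite EFinD; exact: integrableD.
have := (integrable_mkcond (EFin \o u) mU).1 iu.
congr (integrable _ _ _); apply/funext => x /=.
by rewrite !patchE; case: ifP.
Qed.

Definition hgrad_sqr (g : V -> 'rV[R]_N * 'rV[R]_N) (x : V) : R :=
  dotv (g x).1 (g x).1 + dotv (g x).2 (g x).2.

Lemma hgrad_coord_sqr_le d g x : hgrad_coord d g x ^+ 2 <= hgrad_sqr g x.
Proof.
rewrite /hgrad_coord /hgrad_sqr; case: d => -[] i /=.
  by apply: le_trans (sqr_coord_le_dotvv _ _) _; rewrite lerDl dotvv_ge0.
by apply: le_trans (sqr_coord_le_dotvv _ _) _; rewrite lerDr dotvv_ge0.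
Qed.

Lemma hgrad_sqr_ge0 g x : 0 <= hgrad_sqr g x.
Proof. by rewrite addr_ge0// dotvv_ge0. Qed.

Lemma integrable_hgrad_sqr (U : set V) u g : measurable U -> L2_weak_hgrad U u g ->
  mu.-integrable U (EFin \o hgrad_sqr g).
Proof.
move=> mU [gL2 _].
have i1 (f : 'I_N -> V -> R) : (forall i, L2 U (f i)) ->
    mu.-integrable U (fun x => (\sum_(i < N) f i x * f i x)%:E).
  move=> fL2; under eq_fun do rewrite -sumEFin.
  apply: integrable_sum => // i _; have [_] := fL2 i.
  by under eq_fun do rewrite expr2.
have := integrableD mU (i1 (fun i x => (g x).1 ord0 i) (fun i => (gL2 i).1))
  (i1 (fun i x => (g x).2 ord0 i) (fun i => (gL2 i).2)).
by congr (integrable _ _ _).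
Qed.

(** The L1 norm of a component of the gradient is controlled by the L2 norm
    through the inequality 2 |a| <= e + a^2 / e. *)
Lemma hgrad_coord_L1_le (U : set V) u g d (m I e : R) :
  measurable U -> mu U = m%:E -> L2_weak_hgrad U u g -> 0 < e ->
  (\int[mu]_(x in U) (hgrad_sqr g x)%:E <= I%:E)%E ->
  (\int[mu]_(x in U) `|hgrad_coord d g x|%:E <= (e / 2 * m + (2 * e)^-1 * I)%:E)%E.
Proof.
move=> mU Um gU e0 gI.
have ig := integrable_hgrad_sqr mU gU.
have mg : measurable_fun U (hgrad_coord d g).
  by rewrite /hgrad_coord; case: gU => [gL2 _]; case: d => -[] i /=;
    have [[? _] [? _]] := gL2 i.
have mq : measurable_fun U (hgrad_sqr g) by apply/measurable_EFinP;
  exact: measurable_int ig.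
apply: (@le_trans _ _ (\int[mu]_(x in U) ((e / 2)%:E + (2 * e)^-1%:E * (hgrad_sqr g
  x)%:E))%E).
  apply: ge0_le_integral => //.
  - by apply/measurable_EFinP; exact: measurableT_comp.
  - apply: emeasurable_funD => //; apply: emeasurable_funM => //.
    exact/measurable_EFinP.
  - move=> x _; rewrite -EFinM -EFinD lee_fin.
    have := hgrad_coord_sqr_le d g x;
      rewrite -(real_normK (num_real (hgrad_coord d g x))).
    move: `|_| (hgrad_sqr g x) => a q aq.
    have -> : e / 2 + (2 * e)^-1 * q = (e ^+ 2 + q) / (2 * e) by field; rewrite gt_eqF.
    rewrite ler_pdivlMr ?mulr_gt0//; have := sqr_ge0 (e - a); nra.
rewrite ge0_integralD//; last 3 first.
- by move=> x _; rewrite lee_fin divr_ge0// ltW.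
- by move=> x _; rewrite -EFinM lee_fin mulr_ge0 ?hgrad_sqr_ge0// invr_ge0 mulr_ge0// ltW.
- by apply: emeasurable_funM => //; exact/measurable_EFinP.
rewrite (integral_cst mu mU (e / 2)%:E) EFinD; apply: leeD.
  by rewrite [leRHS]EFinM -Um.
rewrite ge0_integralZl//; last 3 first.
- exact/measurable_EFinP.
- by move=> x _; rewrite lee_fin hgrad_sqr_ge0.
- by rewrite lee_fin invr_ge0 mulr_ge0// ltW.
by rewrite EFinM lee_pmul2l// lte_fin invr_gt0 mulr_gt0.
Qed.

Lemma hgradP (U : set V) (u : V -> R) : W12 U u -> L2_weak_hgrad U u (hgrad U u).
Proof. by move=> [_ gU]; exact: (xgetPex (fun=> 0) gU). Qed.

Lemma integral_hgrad_sqr_le (U : set V) (u : V -> R) (B : R) : measurable U ->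
  W12 U u -> W12_seminorm U u <= B ->
  (\int[mu]_(x in U) (hgrad_sqr (hgrad U u) x)%:E <= (B ^+ 2)%:E)%E.
Proof.
move=> mU /hgradP gU; have ig := integrable_hgrad_sqr mU gU.
have := integrable_fin_num mU ig => fin.
rewrite /W12_seminorm => HB; rewrite -(fineK fin) lee_fin.
have I0 : 0 <= fine (\int[mu]_(x in U) (hgrad_sqr (hgrad U u) x)%:E)%E.
  by apply: fine_ge0; apply: integral_ge0 => x _; rewrite lee_fin hgrad_sqr_ge0.
rewrite -(sqr_sqrtr I0) ler_pXn2r ?nnegrE ?sqrtr_ge0//.
exact: le_trans (sqrtr_ge0 _) HB.
Qed.

End sobolev_bounds.

Section clustering.
Variables (R : realType) (N : nat).
Local Notation V := (heis R N).
Local Notation mu := (@heis_measure R N).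

Definition unit_ball_measure : R := fine (mu (heis_ball (0%R : V) 1%R)).

Lemma unit_ball_measure_gt0 : 0 < unit_ball_measure.
Proof.
have [w0 woo] := heis_measure_unit_ball R N.
by rewrite -lte_fin fineK// gt0_fin_numE.
Qed.

Lemma heis_measure_ballE (xi0 : V) (r : R) : 0 < r ->
  mu (heis_ball xi0 r) = (r ^+ (2 * N).+2 * unit_ball_measure)%:E.
Proof.
move=> r0; have [w0 woo] := heis_measure_unit_ball R N.
by rewrite heis_measure_ball_scale// [RHS]EFinM /unit_ball_measure fineK// gt0_fin_numE.
Qed.

Lemma measurable_superlevel (U : set V) (u : V -> R) (t : R) : measurable U ->
  measurable_fun U u -> measurable (superlevel U u t).
Proof.
move=> mU mu_; rewrite (_ : superlevel U u t = U `&` u @^-1` `]t, +oo[%classic).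
  exact: mu_.
by apply/seteqP; split => x; rewrite /superlevel /= in_itv /= andbT.
Qed.

Lemma superlevel_restrict (U : set V) (u : V -> R) (t : R) (x : V) : 0 <= t ->
  t < (u \_ U) x -> superlevel U u t x.
Proof.
move=> t0; rewrite patchE; case: ifPn => [|_].
  by rewrite inE.
by move=> /(le_lt_trans t0); rewrite ltxx.
Qed.

(** With theta = 1 - alpha / (2 Q), Bernoulli's inequality gives
    theta^Q >= 1 - alpha / 2, so the shell between the two balls is at most half
    as large as the superlevel set. *)
Lemma superlevel_shrunk_ball (xi0 : V) (rho alpha c : R) (u : V -> R) :
  0 < rho -> 0 < alpha < 1 -> measurable_fun (heis_ball xi0 rho) u ->
  let U := heis_ball xi0 rho in
  let K := heis_ball xi0 ((1 - alpha / (2 * (2 * N).+2%:R)) * rho) in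
  (alpha%:E * mu U < mu (superlevel U u c `&` U))%E ->
  ((alpha / 2 * (rho ^+ (2 * N).+2 * unit_ball_measure))%:E <=
    mu (superlevel U u c `&` K))%E.
Proof.
move=> rho0 /andP[a0 a1] mu_ U K.
pose Q := (2 * N).+2; pose theta := 1 - alpha / (2 * Q%:R).
have Q0 : 0 < Q%:R :> R by rewrite ltr0n.
have x0 : 0 <= alpha / (2 * Q%:R) by rewrite divr_ge0 ?mulr_ge0// ltW.
have Q1 : 1 <= Q%:R :> R by rewrite ler1n.
have x1 : alpha / (2 * Q%:R) < 1 by rewrite ltr_pdivrMr ?mulr_gt0//; lra.
have theta0 : 0 < theta by rewrite subr_gt0.
have theta1 : theta <= 1 by rewrite /theta lerBlDr lerDl.
have thetaQ : 1 - alpha / 2 <= theta ^+ Q.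
  have := @bernoulli_le R (alpha / (2 * Q%:R)) Q; rewrite x0 (ltW x1) => /(_ isT).
  by apply: le_trans; rewrite le_eqVlt; apply/orP; left; apply/eqP; field; rewrite gt_eqF.
have mU : measurable U by exact: measurable_heis_ball.
have mK : measurable K by exact: measurable_heis_ball.
have KU : K `<=` U.
  by move=> x /lt_le_trans; apply; rewrite -[leRHS]mul1r ler_wpM2r// ltW.
have mS : measurable (superlevel U u c) by exact: measurable_superlevel.
have Um : mu U = (rho ^+ Q * unit_ball_measure)%:E by exact: heis_measure_ballE.
have Km : mu K = ((theta * rho) ^+ Q * unit_ball_measure)%:E.
  by apply: heis_measure_ballE; rewrite mulr_gt0.
rewrite Um => H.
have mUK : mu (U `\` K) = (rho ^+ Q * unit_ball_measure - (theta * rho) ^+ Q *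
  unit_ball_measure)%:E.
  rewrite measureD//; last by rewrite [X in (X < _)%E]Um ltry.
  by rewrite (setIidr KU) [X in (X - _)%E]Um [X in (_ - X)%E]Km.
have H2 : (mu (superlevel U u c `&` U) <= mu (superlevel U u c `&` K) + mu (U `\` K))%E.
  apply: le_trans (measureU2 _ _ _); [|exact: measurableI|exact: measurableD].
  apply: le_measure; rewrite ?inE; [exact: measurableI| |].
    by apply: measurableU; [exact: measurableI|exact: measurableD].
  by move=> x [Sx Ux]; have [Kx|nKx] := pselect (K x); [left|right].
have {H H2} := lt_le_trans H H2; rewrite mUK.
have w0 := unit_ball_measure_gt0.
have V0 : 0 < rho ^+ Q * unit_ball_measure by rewrite mulr_gt0// exprn_gt0.
have : (0 <= mu (superlevel U u c `&` K))%E by [].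
rewrite (_ : (theta * rho) ^+ Q * unit_ball_measure =
  theta ^+ Q * (rho ^+ Q * unit_ball_measure)); last by rewrite exprMn -[LHS]mulrA.
move: (rho ^+ Q * unit_ball_measure) V0 => v v0.
case: (mu _) => [a||]//=; last by move=> _ _; rewrite leey.
rewrite -EFinD -EFinM lte_fin !lee_fin => _ H.
have : (1 - alpha / 2) * v <= theta ^+ Q * v by rewrite ler_wpM2r// ltW.
move: H; lra.
Qed.

Lemma expr_hom_dim (x : R) : x ^+ (2 * N).+2 = x ^+ N.+1 * x ^+ N.+1.
Proof. by rewrite -[RHS]exprD addSn addnS mul2n addnn. Qed.

End clustering.

Theorem lemma6p1 (R : realType) (N : nat) (s alpha delta lambda : R)
    (hN : (1 <= N)%N) (hs : 0 < s < 1) (halpha : 0 < alpha < 1)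
    (hdelta : 0 < delta < 1) (hlambda : 0 < lambda < 1) :
  exists k : R -> R, (forall b : R, 0 < b -> 0 < k b < 1) /\
  forall (rho0 rho c B : R) (xi0 : heis R N) (u : heis R N -> R),
    0 < rho -> rho < rho0 -> 0 < c -> 0 < B ->
    W12 (heis_ball xi0 rho) u ->
    (alpha%:E * heis_measure (heis_ball xi0 rho) <
       heis_measure
         (superlevel (heis_ball xi0 rho) u c `&` heis_ball xi0 rho))%E ->
    W12_seminorm (heis_ball xi0 rho) u <= B ->
    exists xi_star : heis R N, heis_ball xi0 rho xi_star /\
      let r := k (scaled_bound N c rho B) * rho in
      ((1 - delta)%:E * heis_measure (heis_ball xi_star r) <
         heis_measure
           (superlevel (heis_ball xi0 rho) u (lambda * c)
              `&` heis_ball xi_star r))%E.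
Proof.
have /andP[a0 a1] := halpha; have /andP[d0 d1] := hdelta.
have /andP[l0 l1] := hlambda.
pose om := unit_ball_measure R N; have om0 : 0 < om := unit_ball_measure_gt0 R N.
pose n := (N + N + 4)%N; pose Q := (2 * N).+2.
have n1 : 1 <= n%:R :> R by rewrite ler1n /n addn4.
have Q2 : 2 <= Q%:R :> R by rewrite ler_nat.
have n0 : 0 < n%:R :> R by apply: lt_le_trans n1.
have Q0 : 0 < Q%:R :> R by apply: lt_le_trans Q2.
(* Small enough for n k <= alpha / (2 Q), which keeps the paths inside U, and for
   n k b (om + 1) / 2 < delta (1 - lambda) (alpha / 2) om, which makes the mean
   oscillation small. *)
pose kap := delta * (1 - lambda) * alpha * om / (n%:R * (om + 1) * (2 * Q%:R)).
have om10 : 0 < om + 1 by rewrite ltr_wpDl// ltW.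
have l10 : 0 < 1 - lambda by rewrite subr_gt0.
have kap0 : 0 < kap by rewrite divr_gt0// ?mulr_gt0.
have nkE : n%:R * kap * ((om + 1) * (2 * Q%:R)) = delta * (1 - lambda) * alpha * om.
  by rewrite /kap; field; rewrite !gt_eqF.
pose k b := kap / (1 + b).
have kpos b : 0 < b -> 0 < k b by move=> b0; rewrite divr_gt0// ltr_wpDl.
have kb b : 0 < b -> k b * b < kap /\ k b < kap.
  move=> b0; have b1 : 0 < 1 + b by rewrite addr_gt0.
  have E : k b * (1 + b) = kap by rewrite /k mulfVK// gt_eqF.
  by have := kpos b b0; split; rewrite -E; nra.
have nkap : n%:R * kap < alpha / (2 * Q%:R).
  rewrite ltr_pdivlMr ?mulr_gt0// -(ltr_pM2r om10) -mulrA [_ * (om + 1)]mulrC nkE.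
  have : delta * (1 - lambda) < 1 by nra.
  have : 0 < alpha * om by rewrite mulr_gt0.
  nra.
have kap1 : kap < 1.
  have : alpha / (2 * Q%:R) < 1 by rewrite ltr_pdivrMr ?mulr_gt0//; lra.
  nra.
exists k; split=> [b b0|].
  by rewrite kpos//=; apply: lt_trans kap1; exact: (kb b b0).2.
move=> rho0 rho c B xi0 u rho_gt0 _ c0 B0 W U_alpha UB.
set b := scaled_bound N c rho B.
have rN : 0 < rho ^+ N by rewrite exprn_gt0.
have b0 : 0 < b by rewrite divr_gt0 ?mulr_gt0.
have [kbb kbk] := kb b b0; have kb0 := kpos b b0.
pose h := k b * rho; have h0 : 0 < h by rewrite mulr_gt0.
pose U := heis_ball xi0 rho.
have mU : measurable U by exact: measurable_heis_ball.
have Um : heis_measure U = (rho ^+ Q * om)%:E by exact: heis_measure_ballE.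
have Uoo : (heis_measure U < +oo)%E by rewrite Um ltry.
have muU : measurable_fun U u by case: W => -[].
have iu := L2_integrable mU Uoo W.1.
have gU := hgradP W.
have rN1 : 0 < rho ^+ N.+1 by rewrite exprn_gt0.
(* This e makes both terms of the L1 bound of order B rho^(N+1). *)
pose e := B / rho ^+ N.+1; have e0 : 0 < e by rewrite divr_gt0.
pose G := e / 2 * (rho ^+ Q * om) + (2 * e)^-1 * B ^+ 2.
have gG d := hgrad_coord_L1_le d mU Um gU e0 (integral_hgrad_sqr_le mU W UB).
have mg d : measurable_fun U (hgrad_coord d (hgrad U u)).
  by rewrite /hgrad_coord; case: gU => [gL2 _]; case: d => -[] i /=;
    have [[? _] [? _]] := gL2 i.
have GE : G = B * rho ^+ N.+1 * (om + 1) / 2.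
  have rQ : rho ^+ Q = rho ^+ N.+1 * rho ^+ N.+1.
    exact: expr_hom_dim.
  rewrite /G /e rQ; move: (rho ^+ N.+1) rN1 => p p0.
  by field; rewrite !gt_eqF.
have G0 : 0 <= G by rewrite GE divr_ge0// ltW// !mulr_gt0.
pose K := heis_ball xi0 ((1 - alpha / (2 * Q%:R)) * rho).
have mK : measurable K by exact: measurable_heis_ball.
have HA := superlevel_shrunk_ball rho_gt0 halpha muU U_alpha.
pose A := superlevel U u c `&` K.
have mA : measurable A by apply: measurableI => //; exact: measurable_superlevel.
pose Wb := heis_ball (0 : heis R N) h.
have mW : measurable Wb by exact: measurable_heis_ball.
have Wm : heis_measure Wb = (h ^+ Q * om)%:E by exact: heis_measure_ballE.
pose M := delta * ((1 - lambda) * c) * (h ^+ Q * om).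
have lc0 : 0 < (1 - lambda) * c by rewrite mulr_gt0.
have hQ : 0 < h ^+ Q * om by rewrite mulr_gt0// exprn_gt0.
have M0 : 0 < M by apply: mulr_gt0 hQ; exact: mulr_gt0.
have mw : measurable_fun setT (u \_ U) by apply/(measurable_restrictT _ mU).
have i0 : 'I_N by exact: (Ordinal hN).
have HC zeta : Wb zeta ->
    (\int[@heis_measure R N]_(x in K) `|(u \_ U) (heis_mul x zeta) - (u \_ U) x|%:E
     <= (n%:R * h * G)%:E)%E.
  rewrite /Wb heis_ball0E => /ltW zh.
  have [_] := reachable_ball iu gU.2 mg gG G0 (ltW h0) i0 zh.
  apply; rewrite /h mulrA -mulrDl -[ltRHS]mul1r ltr_pM2r//.
  rewrite -[ltRHS](subrK (alpha / (2 * Q%:R))) ltrD2l.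
  by apply: lt_trans nkap; rewrite ltr_pM2l.
have small : ((n%:R * h * G)%:E * heis_measure Wb < M%:E * heis_measure A)%E.
  apply: (@lt_le_trans _ _ (M%:E * (alpha / 2 * (rho ^+ Q * om))%:E)%E); last first.
    by rewrite lee_pmul2l// lte_fin.
  rewrite Wm -!EFinM lte_fin /M [ltRHS]mulrAC ltr_pM2r//.
  have -> : n%:R * h * G = n%:R * (k b * b) * (om + 1) / 2 * (c * rho ^+ Q).
    have rQ : rho ^+ Q = rho ^+ N * rho * (rho ^+ N * rho).
      by rewrite [LHS]expr_hom_dim [in LHS]exprSr.
    rewrite GE /h rQ exprSr /b /scaled_bound.
    move: (rho ^+ N) rN => p p0; move: (k _) => kk.
    by field; rewrite !gt_eqF.
  have cr : 0 < c * rho ^+ Q by rewrite mulr_gt0// exprn_gt0.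
  have -> : delta * ((1 - lambda) * c) * (alpha / 2 * (rho ^+ Q * om)) =
    delta * (1 - lambda) * alpha * om / 2 * (c * rho ^+ Q) by ring.
  rewrite ltr_pM2r// ltr_pM2r// -nkE.
  have H1 : n%:R * (k b * b) < n%:R * kap by rewrite ltr_pM2l.
  have H2 : n%:R * (k b * b) * (om + 1) < n%:R * kap * (om + 1) by rewrite ltr_pM2r.
  apply: lt_le_trans H2 _; rewrite [leRHS]mulrA ler_peMr//; last by move: Q2; lra.
  by apply: mulr_ge0; apply: ltW => //; exact: mulr_gt0.
have AK : A `<=` K by move=> x [].
have [x [Sx Kx] Hx] := exists_small_mean_oscillation mw mA mK mW AK (ltW M0) HC small.
have Ux : U x by case: Sx.
exists x; split => //=.
have wx : c < (u \_ U) x by rewrite patchE mem_set//; case: Sx.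
have := superlevel_density mw mW Wm c0 l1 wx Hx.
rewrite -/h heis_measure_ballE// -EFinM => /lt_le_trans; apply.
have mS : measurable (superlevel U u (lambda * c)) by exact: measurable_superlevel.
have mSx : measurable (superlevel U u (lambda * c) `&` heis_ball x h).
  by apply: measurableI => //; exact: measurable_heis_ball.
have [mf mpres] := preserves_measure_mull x; rewrite -(mpres _ mSx).
apply: le_measure; rewrite ?inE.
- apply: measurableI => //; apply: measurable_gt.
  exact: measurableT_comp mw mf.
- exact: (measurable_preimage mf mSx).
- move=> z [zW /= wz]; split; first by apply: superlevel_restrict => //;
  rewrite mulr_ge0// ltW.
  by move: zW; rewrite /Wb -(heis_ball_mull x) heis_mulg0.
Qed.
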